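(* Let an instance of TSPN consist of $n$ vertical line segments in $\mathbb{R}^2$, each of length exactly $1$, and let $\mathrm{opt}$ be the cost of an optimum tour. For any $\varepsilon>0$ there is a feasible tour $\mathcal{O}'$ of cost at most $(1+\varepsilon)\cdot\mathrm{opt}$ such that for every horizontal strip of height $1$ (the closed region between two horizontal lines at vertical distance $1$), the shadow of the restriction of $\mathcal{O}'$ to that strip is $O(1/\varepsilon)$.
   Context: TSPN over line segments: a tour is a cyclic sequence of points $p_1,\dots,p_\sigma$ joined consecutively by straight line segments called legs (with $p_\sigma$ joined to $p_1$), such that each input segment contains at least one $p_j$; its cost is the total length of its legs; an optimum tour has minimum cost. The restriction of a tour to a strip is the collection of the pieces (sub-legs) of the tour lying inside the strip. Shadow: for a collection of paths made of straight pieces and a real $x_0$, the shadow at $x_0$ is the number of pieces that intersect the vertical line $x=x_0$; the shadow of the collection is the maximum of the shadow at $x_0$ over all $x_0\in\mathbb{R}$. *)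

(* Defs.v *)
From Stdlib Require Import Reals Lra List ClassicalEpsilon.
Import ListNotations.
Open Scope R_scope.

Definition point : Type := (R * R)%type.

Definition dist2 (p q : point) : R :=
  sqrt ((fst p - fst q) ^ 2 + (snd p - snd q) ^ 2).

(* An input segment is a vertical segment of length exactly 1, encoded by
   (x, b): the segment {x} x [b, b+1]. *)
Definition vseg : Type := (R * R)%type.

Definition on_vseg (s : vseg) (p : point) : Prop :=
  fst p = fst s /\ snd s <= snd p <= snd s + 1.

(* A tour is a cyclic sequence p_1, ..., p_sigma (sigma >= 1) of points. *)
Definition tour : Type := list point.

Definition legs (t : tour) : list (point * point) :=
  match t with
  | [] => []
  | h :: tl => combine t (tl ++ [h])
  end.

Definition cost (t : tour) : R :=
  fold_right (fun l acc => dist2 (fst l) (snd l) + acc) 0 (legs t).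

Definition feasible (inst : list vseg) (t : tour) : Prop :=
  t <> [] /\ forall s, In s inst -> exists p, In p t /\ on_vseg s p.

Definition piece_meets (a x0 : R) (l : point * point) : Prop :=
  exists lam : R, 0 <= lam <= 1 /\
    fst (fst l) + lam * (fst (snd l) - fst (fst l)) = x0 /\
    a <= snd (fst l) + lam * (snd (snd l) - snd (fst l)) <= a + 1.

Definition decide (P : Prop) : bool :=
  if excluded_middle_informative P then true else false.

Definition shadow_at (t : tour) (a x0 : R) : nat :=
  length (filter (fun l => decide (piece_meets a x0 l)) (legs t)).

(* Main.v *)
Require Import Defs.
From Stdlib Require Import Reals List.
From Stdlib Require Import Lra Lia Permutation ClassicalEpsilon Sorted PeanoNat.
Import ListNotations.
Open Scope R_scope.

(* Take a tour that is optimal up to a factor close to 1 and view it as a closed walk in an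
   undirected multigraph.  Cut it along horizontal lines at distance 1.  Inside one strip call
   an abscissa heavy if more than [K ~ 1 / eps] edges cross it; the heavy abscissas have total
   length at most [cost / K].  Cut the strip at light abscissas so that the vertices inside
   each piece span an interval consisting of heavy gaps only.  A unit segment visited inside a
   piece contains the point above or below the visit at the maximal or minimal height of
   these vertices.  Hence one may add closed detours along the two horizontal lines at these
   heights, shortcut every vertex strictly between the lines, and let each edge joining two
   line points run along the lines and, if it changes line, through one common edge.  Of three
   parallel copies of an edge two can be deleted, so that the cost grows only by a constant
   times the heavy length, and what remains at each abscissa is a bounded number of edges
   together with the at most [2 K] edges that meet the two light cuts of the piece. *)

(** * Euclidean distance and affine interpolation *)

Lemma dist2_euc (p q : point) : dist2 p q = dist_euc (fst p) (snd p) (fst q) (snd q).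
Proof. unfold dist2, dist_euc. now rewrite !Rsqr_pow2. Qed.

Lemma dist2_nonneg (p q : point) : 0 <= dist2 p q.
Proof. apply sqrt_pos. Qed.

Lemma dist2_sym (p q : point) : dist2 p q = dist2 q p.
Proof. rewrite !dist2_euc. apply distance_symm. Qed.

Lemma dist2_refl (p : point) : dist2 p p = 0.
Proof. rewrite dist2_euc. apply distance_refl. Qed.

Lemma dist2_triangle (p q r : point) : dist2 p q <= dist2 p r + dist2 r q.
Proof. rewrite !dist2_euc. apply triangle. Qed.

Lemma dist2_ge_fst (p q : point) : Rabs (fst p - fst q) <= dist2 p q.
Proof.
  unfold dist2. rewrite <- sqrt_Rsqr_abs. apply sqrt_le_1_alt. rewrite Rsqr_pow2.
  pose proof (pow2_ge_0 (fst p - fst q)); pose proof (pow2_ge_0 (snd p - snd q)); lra.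
Qed.

Lemma dist2_ge_snd (p q : point) : Rabs (snd p - snd q) <= dist2 p q.
Proof.
  unfold dist2. rewrite <- sqrt_Rsqr_abs. apply sqrt_le_1_alt. rewrite Rsqr_pow2.
  pose proof (pow2_ge_0 (fst p - fst q)); pose proof (pow2_ge_0 (snd p - snd q)); lra.
Qed.

Lemma dist2_le_taxicab (p q : point) :
  dist2 p q <= Rabs (fst p - fst q) + Rabs (snd p - snd q).
Proof.
  unfold dist2. rewrite <- (sqrt_Rsqr (Rabs (fst p - fst q) + Rabs (snd p - snd q))).
  2: pose proof (Rabs_pos (fst p - fst q)); pose proof (Rabs_pos (snd p - snd q)); lra.
  apply sqrt_le_1_alt. rewrite <- (pow2_abs (fst p - fst q)), <- (pow2_abs (snd p - snd q)).
  unfold Rsqr. pose proof (Rabs_pos (fst p - fst q)); pose proof (Rabs_pos (snd p - snd q)). nra.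
Qed.

Definition lerp (u v : point) (lam : R) : point :=
  (fst u + lam * (fst v - fst u), snd u + lam * (snd v - snd u)).

Lemma dist2_lerp_l (u v : point) (lam : R) :
  0 <= lam -> dist2 u (lerp u v lam) = lam * dist2 u v.
Proof.
  intros H. unfold dist2, lerp; cbn [fst snd].
  rewrite <- (sqrt_square lam H) at 3. rewrite <- sqrt_mult_alt by nra.
  f_equal. ring.
Qed.

Lemma dist2_lerp (u v : point) (lam : R) :
  0 <= lam <= 1 -> dist2 u (lerp u v lam) + dist2 (lerp u v lam) v = dist2 u v.
Proof.
  intros H. rewrite dist2_lerp_l by lra.
  assert (Hs : lerp u v lam = lerp v u (1 - lam)) by (unfold lerp; f_equal; ring).
  pose proof (dist2_lerp_l u v lam ltac:(lra)) as H1.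
  pose proof (dist2_lerp_l v u (1 - lam) ltac:(lra)) as H2.
  rewrite <- Hs, (dist2_sym v (lerp u v lam)), (dist2_sym v u) in H2. lra.
Qed.

(** * Edges and their multiplicities in edge lists *)

Definition edge : Type := (point * point)%type.

Lemma edge_dec (e e' : edge) : {e = e'} + {e <> e'}.
Proof. apply excluded_middle_informative. Qed.

Definition hit (x y : edge) : nat := if edge_dec x y then 1%nat else 0%nat.

Lemma count_occ_cons_hit (x y : edge) (l : list edge) :
  count_occ edge_dec (x :: l) y = (hit x y + count_occ edge_dec l y)%nat.
Proof. unfold hit. simpl. now destruct (edge_dec x y). Qed.

Lemma count_occ_nil_edge (y : edge) : count_occ edge_dec [] y = 0%nat.
Proof. reflexivity. Qed.

(** Permutations become equations between the multiplicities of an arbitrary edge. Each [hit] is an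
    atom, so that linear arithmetic remains. *)
Ltac perm :=
  repeat match goal with
    | H : Permutation _ _ |- _ =>
        let H' := fresh in
        pose proof (proj1 (Permutation_count_occ edge_dec _ _) H) as H'; clear H; rename H' into H
    end;
  apply (Permutation_count_occ edge_dec);
  let y := fresh "y" in intro y;
  repeat match goal with
    | H : forall _ : edge, count_occ _ _ _ = count_occ _ _ _ |- _ => specialize (H y)
    end;
  rewrite ?count_occ_app, ?count_occ_cons_hit, ?count_occ_app, ?count_occ_cons_hit,
    ?count_occ_app, ?count_occ_cons_hit, ?count_occ_nil_edge in *; lia.

(** * Closed walks in undirected multigraphs *)

Definition joins (e : edge) (u v : point) : Prop := e = (u, v) \/ e = (v, u).

Lemma joins_sym (e : edge) (u v : point) : joins e u v -> joins e v u.
Proof. unfold joins; tauto. Qed.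

Lemma joins_self (e : edge) : joins e (fst e) (snd e).
Proof. left. now destruct e. Qed.

Lemma joins_unique (e : edge) (u v a b : point) :
  joins e u v -> joins e a b -> (a = u /\ b = v) \/ (a = v /\ b = u).
Proof. intros [->| ->] [H|H]; inversion H; auto. Qed.

Definition vertex (p : point) (E : list edge) : Prop :=
  exists e, In e E /\ (p = fst e \/ p = snd e).

Lemma vertex_app (p : point) (E F : list edge) :
  vertex p (E ++ F) <-> vertex p E \/ vertex p F.
Proof.
  unfold vertex. split.
  - intros (e & He & Hp). apply in_app_iff in He. destruct He; [left|right]; eauto.
  - intros [(e & He & Hp)|(e & He & Hp)]; exists e; rewrite in_app_iff; auto.
Qed.

Lemma vertex_cons (p : point) (e : edge) (E : list edge) :
  vertex p (e :: E) <-> p = fst e \/ p = snd e \/ vertex p E.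
Proof.
  unfold vertex. split.
  - intros (e' & [->|He] & Hp); [tauto|]. right; right; eauto.
  - intros [H|[H|(e' & He & Hp)]]; [exists e|exists e|exists e']; simpl; auto.
Qed.

Lemma vertex_nil (p : point) : ~ vertex p [].
Proof. intros (e & [] & _). Qed.

Lemma vertex_perm (p : point) (E F : list edge) :
  Permutation E F -> vertex p E -> vertex p F.
Proof.
  intros HP (e & He & Hp). exists e. split; auto. eapply Permutation_in; eauto.
Qed.

Lemma vertex_incl (p : point) (E F : list edge) : incl E F -> vertex p E -> vertex p F.
Proof. intros HP (e & He & Hp). exists e; auto. Qed.

Lemma vertex_joins_l (e : edge) (u v : point) (E : list edge) :
  joins e u v -> vertex u (e :: E).
Proof. intros [->| ->]; apply vertex_cons; simpl; auto. Qed.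

Lemma vertex_joins_cons (e : edge) (u v p : point) (E : list edge) :
  joins e u v -> (vertex p (e :: E) <-> p = u \/ p = v \/ vertex p E).
Proof. rewrite vertex_cons. intros [->| ->]; simpl; tauto. Qed.

(** Through [walk_perm] the list counts only as a multiset: [walk u v E] says that the edges of [E],
    each used exactly once and in either direction, can be arranged into an Euler trail from [u] to
    [v]. *)
Inductive walk : point -> point -> list edge -> Prop :=
| walk_nil u : walk u u []
| walk_cons u v w e E : joins e u v -> walk v w E -> walk u w (e :: E)
| walk_perm u v E F : Permutation E F -> walk u v E -> walk u v F.

Lemma walk_app (u v w : point) (E F : list edge) :
  walk u v E -> walk v w F -> walk u w (E ++ F).
Proof.
  induction 1 as [u|u v' w' e E Hj Hw IH|u v' E E' HP Hw IH]; intros HF; simpl; auto.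
  - econstructor; eauto.
  - eapply walk_perm; [|now apply IH]. now apply Permutation_app_tail.
Qed.

Lemma walk_edge (e : edge) (u v : point) : joins e u v -> walk u v [e].
Proof. intros H. econstructor; eauto. constructor. Qed.

Lemma walk_sym (u v : point) (E : list edge) : walk u v E -> walk v u E.
Proof.
  induction 1 as [u|u v' w' e E Hj Hw IH|u v' E E' HP Hw IH].
  - constructor.
  - apply walk_perm with (E ++ [e]); [perm|].
    eapply walk_app; eauto. apply walk_edge. now apply joins_sym.
  - eapply walk_perm; eauto.
Qed.

Lemma walk_split_edge (u v : point) (e : edge) (E : list edge) :
  walk u v E -> In e E ->
  exists a b E1 E2, joins e a b /\ walk u a E1 /\ walk b v E2 /\ Permutation E (e :: E1 ++ E2).
Proof.
  induction 1 as [u|u v' w' f E Hj Hw IH|u v' E E' HP Hw IH]; intros Hin.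
  - destruct Hin.
  - destruct Hin as [->|Hin].
    + exists u, v', [], E. simpl. repeat split; auto. constructor.
    + destruct (IH Hin) as (a & b & E1 & E2 & H1 & H2 & H3 & H4).
      exists a, b, (f :: E1), E2. repeat split; auto. econstructor; eauto. perm.
  - apply Permutation_sym in HP as HP'.
    destruct (IH (Permutation_in _ HP' Hin)) as (a & b & E1 & E2 & H1 & H2 & H3 & H4).
    exists a, b, E1, E2. repeat split; auto. perm.
Qed.

Lemma walk_split_vertex (u v p : point) (E : list edge) :
  walk u v E -> p = u \/ vertex p E ->
  exists E1 E2, walk u p E1 /\ walk p v E2 /\ Permutation E (E1 ++ E2).
Proof.
  intros Hw [->|(e & He & Hp)].
  - exists [], E. repeat split; auto. constructor.
  - destruct (walk_split_edge _ _ _ _ Hw He) as (a & b & E1 & E2 & H1 & H2 & H3 & H4).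
    assert (Hab : p = a \/ p = b) by (destruct H1 as [->| ->]; simpl in Hp; tauto).
    destruct Hab as [->| ->].
    + exists E1, (e :: E2). repeat split; auto. econstructor; eauto. perm.
    + exists (E1 ++ [e]), E2. repeat split; auto.
      * eapply walk_app; eauto. now apply walk_edge.
      * perm.
Qed.

Definition closed (E : list edge) : Prop := exists u, walk u u E.

Lemma closed_perm (E F : list edge) : Permutation E F -> closed E -> closed F.
Proof. intros HP [u Hu]. exists u. eapply walk_perm; eauto. Qed.

(** The circuit is split at [p] and its two parts are exchanged. *)
Lemma closed_at (p : point) (E : list edge) : closed E -> vertex p E -> walk p p E.
Proof.
  intros [u Hu] Hp.
  destruct (walk_split_vertex _ _ p _ Hu (or_intror Hp)) as (E1 & E2 & H1 & H2 & H3).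
  apply walk_perm with (E2 ++ E1); [perm|]. eapply walk_app; eauto.
Qed.

(** Starting the circuit just after [e] leaves a trail between the ends of [e]. The direction in
    which [e] was traversed is unknown, and reversing the trail settles it. *)
Lemma closed_open (e : edge) (u v : point) (R : list edge) :
  closed (e :: R) -> joins e u v -> walk u v R.
Proof.
  intros [w Hw] Hj.
  destruct (walk_split_edge _ _ e _ Hw (or_introl eq_refl))
    as (a & b & E1 & E2 & H1 & H2 & H3 & H4).
  assert (Hba : walk b a R).
  { apply walk_perm with (E2 ++ E1); [perm|]. eapply walk_app; eauto. }
  destruct (joins_unique _ _ _ _ _ Hj H1) as [[-> ->]|[-> ->]]; auto using walk_sym.
Qed.

Lemma closed_join (u v : point) (E F : list edge) :
  walk u v E -> walk u v F -> closed (E ++ F).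
Proof. intros H1 H2. exists u. eapply walk_app; eauto. now apply walk_sym. Qed.

Lemma closed_subst (u v : point) (e : edge) (L R : list edge) :
  closed (e :: R) -> joins e u v -> walk u v L -> closed (L ++ R).
Proof. intros Hc Hj Hw. eapply closed_join; eauto. eapply closed_open; eauto. Qed.

Lemma closed_add_loop (v q : point) (E : list edge) :
  closed E -> vertex v E -> closed ((v, q) :: (v, q) :: E).
Proof.
  intros Hc Hv. exists v. apply walk_cons with q; [now left|].
  apply walk_cons with v; [now right|]. now apply closed_at.
Qed.

(* Of three parallel edges two can be dropped: open the walk at the first copy and split
   it at the second one; if both are traversed the same way, reverse the part in between,
   otherwise the two remaining closed walks are joined by the third copy. *)
Lemma closed_drop_pair (e : edge) (R : list edge) :
  closed (e :: e :: e :: R) -> closed (e :: R).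
Proof.
  intros Hc. destruct e as [u v].
  assert (Hw : walk u v ((u, v) :: (u, v) :: R)) by (eapply closed_open; eauto; now left).
  destruct (walk_split_edge _ _ (u, v) _ Hw (or_introl eq_refl))
    as (a & b & E1 & E2 & H1 & H2 & H3 & H4).
  assert (HP : Permutation ((u, v) :: R) (E1 ++ E2)) by perm.
  assert (Hj : joins (u, v) u v) by now left.
  destruct (joins_unique _ _ _ _ _ Hj H1) as [[-> ->]|[-> ->]].
  - assert (Hin : In (u, v) (E1 ++ E2)) by (eapply Permutation_in; eauto; now left).
    apply in_app_iff in Hin. destruct Hin as [Hin|Hin].
    + apply in_split in Hin. destruct Hin as (l1 & l2 & ->).
      assert (Hu : walk u v (l1 ++ l2)).
      { eapply closed_open with (e := (u, v)); auto. exists u.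
        apply walk_perm with (l1 ++ (u, v) :: l2); [perm|auto]. }
      exists v. apply walk_perm with ((u, v) :: (l1 ++ l2) ++ E2); [perm|].
      apply walk_cons with u; [now right|]. eapply walk_app; eauto.
    + apply in_split in Hin. destruct Hin as (l1 & l2 & ->).
      assert (Hu : walk u v (l1 ++ l2)).
      { eapply closed_open with (e := (u, v)); auto. exists v.
        apply walk_perm with (l1 ++ (u, v) :: l2); [perm|auto]. }
      exists u. apply walk_perm with ((u, v) :: (l1 ++ l2) ++ E1); [perm|].
      apply walk_cons with v; [now left|]. eapply walk_app; eauto. now apply walk_sym.
  - exists u. apply walk_perm with (E1 ++ E2); [perm|].
    eapply walk_app; [exact H2|]. now apply walk_sym.
Qed.

(** This replaces inversion, which [walk_perm] deprives of any information about the first edge. *)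
Lemma walk_first (u v : point) (E : list edge) :
  walk u v E ->
  (E = [] /\ u = v) \/
  exists e w E', joins e u w /\ walk w v E' /\ Permutation E (e :: E').
Proof.
  induction 1 as [u|u v' w' e E Hj Hw IH|u v' E E' HP Hw IH]; auto.
  - right. exists e, v', E. auto.
  - destruct IH as [[-> ->]|(e & w & E1 & H1 & H2 & H3)].
    + left. apply Permutation_nil in HP. auto.
    + right. exists e, w, E1. repeat split; auto. perm.
Qed.

(* The second vertex [q] excludes [E = [(p, p)]]. *)
Lemma closed_delete_vertex (p q : point) (E : list edge) :
  closed E -> vertex p E -> vertex q E -> p <> q ->
  exists u v e1 e2 E', joins e1 u p /\ joins e2 p v /\
    Permutation E (e1 :: e2 :: E') /\ closed ((u, v) :: E').
Proof.
  intros Hc Hp Hq Hpq.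
  destruct (walk_first _ _ _ (closed_at _ _ Hc Hp)) as [[-> _]|(e2 & v & E1 & H1 & H2 & H3)].
  { now apply vertex_nil in Hp. }
  destruct (walk_first _ _ _ (walk_sym _ _ _ H2)) as [[-> ->]|(e1 & u & E2 & H4 & H5 & H6)].
  { exfalso. apply (vertex_perm _ _ _ H3), (vertex_joins_cons _ _ _ _ _ H1) in Hq.
    destruct Hq as [?|[?|Hq]]; try congruence. now apply vertex_nil in Hq. }
  exists u, v, e1, e2, E2. split; [now apply joins_sym|]. split; [auto|]. split; [perm|].
  exists v. apply walk_cons with u; [now right|auto].
Qed.

(** * Sums over edge lists *)

Definition esum (f : edge -> R) (E : list edge) : R :=
  fold_right (fun e acc => f e + acc) 0 E.

Lemma esum_cons (f : edge -> R) (e : edge) (E : list edge) : esum f (e :: E) = f e + esum f E.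
Proof. reflexivity. Qed.

Lemma esum_app (f : edge -> R) (E F : list edge) : esum f (E ++ F) = esum f E + esum f F.
Proof.
  induction E as [|e E IH]; cbn [app]; [simpl; lra|]. rewrite !esum_cons, IH. lra.
Qed.

Lemma esum_perm (f : edge -> R) (E F : list edge) : Permutation E F -> esum f E = esum f F.
Proof. induction 1; rewrite ?esum_cons; lra. Qed.

Lemma esum_le (f g : edge -> R) (E : list edge) :
  (forall e, In e E -> f e <= g e) -> esum f E <= esum g E.
Proof.
  induction E as [|e E IH]; intros H; [simpl; lra|]. rewrite !esum_cons.
  pose proof (H e (or_introl eq_refl)). pose proof (IH (fun x Hx => H x (or_intror Hx))). lra.
Qed.

Lemma esum_zero (f : edge -> R) (E : list edge) :
  (forall e, In e E -> f e = 0) -> esum f E = 0.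
Proof.
  induction E as [|e E IH]; intros H; [reflexivity|].
  rewrite esum_cons, H, IH; simpl; auto; [lra|]. intros; apply H; simpl; auto.
Qed.

Lemma esum_nonneg (f : edge -> R) (E : list edge) :
  (forall e, 0 <= f e) -> 0 <= esum f E.
Proof. intros H. induction E as [|e E IH]; [simpl; lra|]. rewrite esum_cons. pose proof (H e).
  lra. Qed.

Lemma esum_flat_map (f g : edge -> R) (k : edge -> list edge) (E : list edge) :
  (forall e, In e E -> esum f (k e) <= g e) -> esum f (flat_map k E) <= esum g E.
Proof.
  induction E as [|e E IH]; intros H; [simpl; lra|].
  cbn [flat_map]. rewrite esum_app, esum_cons.
  pose proof (H e (or_introl eq_refl)). pose proof (IH (fun x Hx => H x (or_intror Hx))). lra.
Qed.

Lemma esum_flat_map_ge (f g : edge -> R) (k : edge -> list edge) (E : list edge) :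
  (forall e, In e E -> g e <= esum f (k e)) -> esum g E <= esum f (flat_map k E).
Proof.
  induction E as [|e E IH]; intros H; [simpl; lra|].
  cbn [flat_map]. rewrite esum_app, esum_cons.
  pose proof (H e (or_introl eq_refl)). pose proof (IH (fun x Hx => H x (or_intror Hx))). lra.
Qed.

(** Counts are kept as real sums of indicators, so that length and shadow estimates use the same
    lemmas on [esum]. *)
Definition indic (P : Prop) : R := if excluded_middle_informative P then 1 else 0.

Lemma indic_true (P : Prop) : P -> indic P = 1.
Proof. unfold indic. destruct (excluded_middle_informative P); tauto. Qed.

Lemma indic_false (P : Prop) : ~ P -> indic P = 0.
Proof. unfold indic. destruct (excluded_middle_informative P); tauto. Qed.

Lemma indic_bounds (P : Prop) : 0 <= indic P <= 1.
Proof. unfold indic. destruct (excluded_middle_informative P); lra. Qed.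

Lemma indic_le (P Q : Prop) : (P -> Q) -> indic P <= indic Q.
Proof.
  unfold indic.
  destruct (excluded_middle_informative P), (excluded_middle_informative Q); intros; try lra;
    tauto.
Qed.

Lemma indic_le_or (P Q S : Prop) : (P -> Q \/ S) -> indic P <= indic Q + indic S.
Proof.
  unfold indic.
  destruct (excluded_middle_informative P), (excluded_middle_informative Q),
    (excluded_middle_informative S); intros; try lra; tauto.
Qed.

Definition ecost (e : edge) : R := dist2 (fst e) (snd e).

Lemma ecost_nonneg (e : edge) : 0 <= ecost e.
Proof. apply dist2_nonneg. Qed.

Lemma ecost_joins (e : edge) (u v : point) : joins e u v -> ecost e = dist2 u v.
Proof. intros [->| ->]; unfold ecost; simpl; auto using dist2_sym. Qed.

(** Heights are ignored and touching counts, so this bounds from above what happens in any window of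
    a strip. *)
Definition meets (x0 : R) (e : edge) : R :=
  indic (fst (fst e) <= x0 <= fst (snd e) \/ fst (snd e) <= x0 <= fst (fst e)).

Lemma meets_bounds (x0 : R) (e : edge) : 0 <= meets x0 e <= 1.
Proof. apply indic_bounds. Qed.

Lemma esum_meets_zero (x0 : R) (E : list edge) :
  (forall p, vertex p E -> x0 < fst p) \/ (forall p, vertex p E -> fst p < x0) ->
  esum (meets x0) E = 0.
Proof.
  intros H. apply esum_zero. intros e He. apply indic_false.
  assert (H1 : vertex (fst e) E) by (exists e; auto).
  assert (H2 : vertex (snd e) E) by (exists e; auto).
  destruct H as [H|H]; pose proof (H _ H1); pose proof (H _ H2); lra.
Qed.

(** * Bounding multiplicities and rerouting edges *)

Lemma closed_reduce_copies (e : edge) (R : list edge) (n : nat) :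
  closed (repeat e n ++ R) ->
  exists m, (m <= 2)%nat /\ ((0 < n)%nat -> (0 < m)%nat) /\ closed (repeat e m ++ R).
Proof.
  induction n as [n IH] using (well_founded_induction Nat.lt_wf_0). intros Hc.
  destruct n as [|[|[|n]]].
  - exists 0%nat. repeat split; auto; lia.
  - exists 1%nat. repeat split; auto; lia.
  - exists 2%nat. repeat split; auto; lia.
  - destruct (IH (S n)) as (m & H1 & H2 & H3); [lia| |].
    + simpl in *. now apply closed_drop_pair.
    + exists m. repeat split; auto. intros _. apply H2. lia.
Qed.

Lemma partition_copies (e : edge) (L : list edge) :
  exists n L', Permutation L (repeat e n ++ L') /\ ~ In e L'.
Proof.
  induction L as [|a L (n & L' & H1 & H2)].
  - exists 0%nat, []. simpl. auto.
  - destruct (edge_dec a e) as [->|Hn].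
    + exists (S n), L'. simpl. auto.
    + exists n, (a :: L'). split; [|simpl; tauto].
      apply perm_trans with (a :: repeat e n ++ L'); auto. apply Permutation_middle.
Qed.

(** For each edge of [El] in turn, pairs of parallel copies are dropped until at most two are left,
    but never the last copy, so no vertex of [L] is lost. One and the same [L'] works for all
    weights [f], because both the cost and the number of edges at an abscissa have to be bounded. *)
Lemma closed_reduce (El L R : list edge) :
  closed (L ++ R) -> incl L El ->
  exists L', closed (L' ++ R) /\ incl L L' /\ incl L' El /\
    forall f, (forall e, 0 <= f e) -> esum f L' <= 2 * esum f El.
Proof.
  revert L R. induction El as [|e El IH]; intros L R Hc Hi.
  - apply incl_l_nil in Hi. subst L. exists []. repeat split; auto; try apply incl_refl.
    intros; simpl; lra.
  - destruct (partition_copies e L) as (n & L1 & H1 & H2).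
    destruct (closed_reduce_copies e (L1 ++ R) n) as (m & H3 & H4 & H5).
    { apply closed_perm with (L ++ R); [perm|auto]. }
    (* The surviving copies of [e] join the untouched part while the other edges are reduced. *)
    destruct (IH L1 (repeat e m ++ R)) as (L2 & H6 & H7 & H8 & H9).
    { apply closed_perm with (repeat e m ++ L1 ++ R); [perm|auto]. }
    { intros a Ha. assert (Ha' : In a (e :: El)).
      { apply Hi. apply (Permutation_in _ (Permutation_sym H1)). apply in_app_iff; auto. }
      destruct Ha' as [->|]; tauto. }
    exists (repeat e m ++ L2). repeat split.
    + apply closed_perm with (L2 ++ repeat e m ++ R); [perm|auto].
    + intros a Ha. apply (Permutation_in _ H1) in Ha. apply in_app_iff in Ha. apply in_app_iff.
      destruct Ha as [Ha|Ha]; [|right; auto]. left.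
      pose proof (repeat_spec _ _ _ Ha). subst a.
      destruct n; [destruct Ha|]. destruct m; [exfalso; lia|]. simpl; auto.
    + intros a Ha. apply in_app_iff in Ha. destruct Ha as [Ha|Ha].
      * apply repeat_spec in Ha. subst; simpl; auto.
      * right; auto.
    + intros f Hf. rewrite esum_app, esum_cons. pose proof (H9 f Hf). pose proof (Hf e).
      destruct m as [|[|[|m]]]; simpl; try lra. lia.
Qed.

(** Only inclusion in [El] is asked, so the walk may use an edge several times. Being nonempty, it
    has both of its ends as vertices. *)
Definition linked (El : list edge) (u v : point) : Prop :=
  exists L, L <> [] /\ incl L El /\ walk u v L.

Lemma linked_edge (El : list edge) (e : edge) : In e El -> linked El (fst e) (snd e).
Proof.
  intros H. exists [e]. repeat split; [discriminate| |].
  - intros a [->|[]]; auto.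
  - apply walk_edge, joins_self.
Qed.

Lemma linked_trans (El : list edge) (u v w : point) :
  linked El u v -> linked El v w -> linked El u w.
Proof.
  intros (L & H1 & H2 & H3) (L' & H4 & H5 & H6). exists (L ++ L'). repeat split.
  - intros H. apply app_eq_nil in H. tauto.
  - now apply incl_app.
  - eapply walk_app; eauto.
Qed.

Lemma linked_sym (El : list edge) (u v : point) : linked El u v -> linked El v u.
Proof. intros (L & H1 & H2 & H3). exists L. auto using walk_sym. Qed.

Lemma linked_incl (El El' : list edge) (u v : point) :
  incl El El' -> linked El u v -> linked El' u v.
Proof. intros Hi (L & H1 & H2 & H3). exists L. repeat split; auto. now apply incl_tran with El.
  Qed.

Lemma walk_vertex_l (u v : point) (L : list edge) : walk u v L -> L <> [] -> vertex u L.
Proof.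
  intros Hw Hn. destruct (walk_first _ _ _ Hw) as [[? _]|(e & w & E & H1 & _ & H3)]; [tauto|].
  apply (vertex_perm _ _ _ (Permutation_sym H3)). eapply vertex_joins_l; eauto.
Qed.

(** Edges are replaced one at a time by walks in [El]; as these are nonempty, the ends of the
    replaced edges stay visited. *)
Lemma closed_reroute (El H R : list edge) :
  closed (H ++ R) -> (forall e, In e H -> linked El (fst e) (snd e)) ->
  exists L, incl L El /\ closed (L ++ R) /\ forall p, vertex p H -> vertex p L.
Proof.
  revert R. induction H as [|e H IH]; intros R Hc Hl.
  - exists []. repeat split; auto. intros a [].
  - destruct (Hl e (or_introl eq_refl)) as (L1 & H1 & H2 & H3).
    destruct (IH (L1 ++ R)) as (L2 & H4 & H5 & H6).
    { apply closed_perm with (L1 ++ (H ++ R)); [perm|].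
      eapply closed_subst; eauto using joins_self. }
    { intros a Ha. apply Hl. now right. }
    exists (L1 ++ L2). repeat split.
    + now apply incl_app.
    + eapply closed_perm; [|exact H5]. perm.
    + intros p Hp. apply vertex_app. apply vertex_cons in Hp.
      destruct Hp as [->|[->|Hp]]; auto; left.
      * eapply walk_vertex_l; eauto.
      * eapply walk_vertex_l; eauto using walk_sym.
Qed.

(** * Chains of edges along a horizontal line *)

Lemma exists_sorted (Z : list R) :
  exists s, StronglySorted Rlt s /\ forall z, In z s <-> In z Z.
Proof.
  assert (Hins : forall a s, StronglySorted Rlt s ->
    exists s', StronglySorted Rlt s' /\ forall z, In z s' <-> z = a \/ In z s).
  { intros a s. induction s as [|b s IH]; intros Hs.
    - exists [a]. split; [repeat constructor|]. simpl; intuition.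
    - inversion Hs as [|? ? Hs' Hf]; subst.
      destruct (total_order_T a b) as [[Hab|Hab]|Hab].
      + exists (a :: b :: s). split; [|simpl; intuition].
        constructor; auto. constructor; auto.
        eapply Forall_impl; [|exact Hf]. intros; simpl in *; lra.
      + subst. exists (b :: s). split; auto. simpl; intuition.
      + destruct (IH Hs') as (s' & H1 & H2). exists (b :: s'). split.
        * constructor; auto. rewrite Forall_forall in *. intros z Hz.
          apply H2 in Hz. destruct Hz as [->|Hz]; auto.
        * intros z. simpl. rewrite H2. tauto. }
  induction Z as [|a Z (s & H1 & H2)].
  - exists []. split; [constructor|tauto].
  - destruct (Hins a s H1) as (s' & H3 & H4). exists s'. split; auto.
    intros z. rewrite H4, H2. simpl. intuition.
Qed.

(* The degenerate edges make [linked] reflexive on the points of the chain. *)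
Fixpoint chain (y : R) (s : list R) : list edge :=
  match s with
  | [] => []
  | z :: s' =>
      ((z, y), (z, y)) ::
      match s' with [] => [] | z' :: _ => [((z, y), (z', y))] end ++ chain y s'
  end.

Lemma chain_vertex (y : R) (s : list R) (p : point) :
  vertex p (chain y s) -> snd p = y /\ In (fst p) s.
Proof.
  induction s as [|z s IH]; simpl; intros Hp; [now apply vertex_nil in Hp|].
  rewrite vertex_cons, vertex_app in Hp. simpl in Hp.
  destruct Hp as [->|[->|[Hp|Hp]]]; simpl; auto.
  - destruct s as [|z' s]; [now apply vertex_nil in Hp|].
    rewrite vertex_cons in Hp. simpl in Hp.
    destruct Hp as [->|[->|Hp]]; simpl; auto. now apply vertex_nil in Hp.
  - tauto.
Qed.

Lemma chain_linked_head (y : R) (s : list R) (z z' : R) :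
  In z' (z :: s) -> linked (chain y (z :: s)) (z, y) (z', y).
Proof.
  revert z. induction s as [|a s IH]; intros z Hz.
  - destruct Hz as [->|[]]. apply (linked_edge _ ((z', y), (z', y))). simpl; auto.
  - destruct Hz as [->|Hz].
    + apply (linked_edge _ ((z', y), (z', y))). simpl; auto.
    + apply linked_trans with (a, y).
      * apply (linked_edge _ ((z, y), (a, y))). simpl; auto.
      * apply linked_incl with (chain y (a :: s)); [|now apply IH].
        intros e He. change (chain y (z :: a :: s)) with
          (((z, y), (z, y)) :: ((z, y), (a, y)) :: chain y (a :: s)). simpl in *; auto.
Qed.

Lemma chain_cost (y r : R) (z : R) (s : list R) :
  StronglySorted Rlt (z :: s) -> (forall a, In a (z :: s) -> a <= r) ->
  esum ecost (chain y (z :: s)) <= r - z.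
Proof.
  revert z. induction s as [|a s IH]; intros z Hs Hr.
  - cbn [chain app]. rewrite esum_cons. unfold ecost at 1. simpl. rewrite dist2_refl.
    pose proof (Hr z (or_introl eq_refl)). lra.
  - inversion Hs as [|? ? Hs' Hf]; subst. inversion Hf; subst.
    change (chain y (z :: a :: s)) with
      (((z, y), (z, y)) :: ((z, y), (a, y)) :: chain y (a :: s)).
    rewrite !esum_cons. unfold ecost at 1 2. cbn [fst snd]. rewrite dist2_refl.
    pose proof (dist2_le_taxicab (z, y) (a, y)) as Hd. cbn [fst snd] in Hd.
    rewrite Rabs_left, (Rabs_right (y - y)) in Hd by lra.
    specialize (IH a Hs' (fun b Hb => Hr b (or_intror Hb))). lra.
Qed.

(** The worst case is a point of the chain, which lies on its degenerate edge and on both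
    neighbouring edges. At the leftmost point there is no edge to the left; this sharper bound
    carries the induction. *)
Lemma chain_meets (y x0 : R) (z : R) (s : list R) :
  StronglySorted Rlt (z :: s) ->
  esum (meets x0) (chain y (z :: s)) <= 3 /\
  (x0 <= z -> esum (meets x0) (chain y (z :: s)) <= 2).
Proof.
  revert z. induction s as [|a s IH]; intros z Hs.
  - cbn [chain app]. rewrite esum_cons. pose proof (meets_bounds x0 (z, y, (z, y))). simpl. lra.
  - inversion Hs as [|? ? Hs' Hf]; subst. inversion Hf as [|? ? Hza Hf']; subst.
    change (chain y (z :: a :: s)) with
      (((z, y), (z, y)) :: ((z, y), (a, y)) :: chain y (a :: s)).
    rewrite !esum_cons. destruct (IH a Hs') as [IH1 IH2].
    pose proof (meets_bounds x0 (z, y, (z, y))).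
    pose proof (meets_bounds x0 (z, y, (a, y))).
    destruct (Rle_or_lt x0 z) as [H1|H1].
    + rewrite (esum_meets_zero x0 (chain y (a :: s))); [lra|].
      left. intros p Hp. apply chain_vertex in Hp. destruct Hp as [_ Hp].
      inversion Hs' as [|? ? _ Hfa]; subst. rewrite Forall_forall in Hfa.
      destruct Hp as [->|Hp]; [lra|]. apply Hfa in Hp. lra.
    + assert (E1 : meets x0 (z, y, (z, y)) = 0) by (apply indic_false; simpl; lra).
      rewrite E1. destruct (Rle_or_lt x0 a) as [H2|H2].
      * specialize (IH2 H2). lra.
      * assert (E2 : meets x0 (z, y, (a, y)) = 0) by (apply indic_false; simpl; lra). lra.
Qed.

Lemma horizontal_chain (Z : list R) (y l r : R) :
  (forall z, In z Z -> l <= z <= r) -> l <= r ->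
  exists El, esum ecost El <= r - l /\ (forall x0, esum (meets x0) El <= 3) /\
    (forall p, vertex p El -> snd p = y /\ In (fst p) Z) /\
    (forall z z', In z Z -> In z' Z -> linked El (z, y) (z', y)).
Proof.
  intros Hz Hlr. destruct (exists_sorted Z) as (s & Hs & Hin).
  exists (chain y s). destruct s as [|z s].
  - repeat split; try (simpl; intros; lra).
    + now apply chain_vertex in H.
    + apply chain_vertex in H. now apply Hin.
    + intros a b Ha. apply Hin in Ha. destruct Ha.
  - repeat split.
    + assert (Hl : l <= z) by (apply Hz, Hin; simpl; auto).
      assert (Hr : forall a, In a (z :: s) -> a <= r) by (intros; now apply Hz, Hin).
      pose proof (chain_cost y r z s Hs Hr). lra.
    + intros. now apply chain_meets.
    + now apply chain_vertex in H.
    + apply chain_vertex in H. now apply Hin.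
    + intros a b Ha Hb. apply Hin in Ha. apply Hin in Hb.
      apply linked_trans with (z, y); [apply linked_sym|]; now apply chain_linked_head.
Qed.

(** * Surgery in a cell *)

Definition touch (P : point -> Prop) (e : edge) : R := indic (P (fst e) \/ P (snd e)).

Lemma touch_joins (P : point -> Prop) (e : edge) (u v : point) :
  joins e u v -> touch P e = touch P (u, v).
Proof.
  intros [->| ->]; auto. unfold touch. simpl.
  apply Rle_antisym; apply indic_le; tauto.
Qed.

(** Interior vertices are shortcut one visit at a time, and each shortcut removes an edge, which
    bounds the induction. As [R] has no interior vertex, both edges at the visit belong to [E]; the
    vertex [q] supplies the second vertex that a deletion requires. The cost does not grow by the
    triangle inequality, and an end of the shortcut in [P] was already an end of one of the two old
    edges. *)
Lemma closed_eliminate (int : point -> Prop) (n : nat) (E R : list edge) :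
  (length E <= n)%nat -> closed (E ++ R) -> (forall p, vertex p R -> ~ int p) ->
  (exists q, vertex q (E ++ R) /\ ~ int q) ->
  exists E', closed (E' ++ R) /\
    (forall p, vertex p E' -> vertex p E /\ ~ int p) /\
    (forall p, vertex p E -> ~ int p -> vertex p E') /\
    esum ecost E' <= esum ecost E /\
    (forall P, esum (touch P) E' <= esum (touch P) E).
Proof.
  revert E. induction n as [|n IH]; intros E Hn Hc HR (q & Hq & Hqi).
  - destruct E; [|simpl in Hn; lia].
    exists []. repeat split; auto; try lra; try (intros; lra); try now apply vertex_nil in H.
  - destruct (excluded_middle_informative (exists p, vertex p E /\ int p)) as [(p & Hp &
      Hpi)|Hno].
    2: { exists E. repeat split; auto; try lra; try (intros; lra). intros Hpi. eauto. }
    destruct (closed_delete_vertex p q (E ++ R))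
      as (u & v & e1 & e2 & F & H1 & H2 & H3 & H4); auto.
    { apply vertex_app; auto. }
    { intros ->; tauto. }
    assert (Hin : forall e, joins e u p \/ joins e p v -> In e (E ++ R) -> In e E).
    { intros e He Hi. apply in_app_iff in Hi. destruct Hi as [Hi|Hi]; auto.
      exfalso. apply (HR p); auto. exists e; split; auto.
      destruct He as [[->| ->]|[->| ->]]; simpl; auto. }
    assert (Hs : exists E1, Permutation E (e1 :: e2 :: E1)).
    { assert (Hi1 : In e1 E).
      { apply Hin; auto. apply (Permutation_in _ (Permutation_sym H3)); simpl; auto. }
      apply in_split in Hi1. destruct Hi1 as (a1 & a2 & ->).
      assert (HP : Permutation ((a1 ++ a2) ++ R) (e2 :: F)) by perm.
      assert (Hi2 : In e2 (a1 ++ a2)).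
      { assert (Hi2 : In e2 ((a1 ++ a2) ++ R)).
        { apply (Permutation_in _ (Permutation_sym HP)); simpl; auto. }
        apply in_app_iff in Hi2. destruct Hi2 as [Hi2|Hi2]; auto.
        exfalso. apply (HR p); auto. exists e2; split; auto.
        destruct H2 as [->| ->]; simpl; auto. }
      apply in_split in Hi2. destruct Hi2 as (b1 & b2 & Hb).
      exists (b1 ++ b2). apply perm_trans with (e1 :: a1 ++ a2); [perm|]. rewrite Hb. perm. }
    destruct Hs as (E1 & HE).
    assert (HF : Permutation F (E1 ++ R)) by perm.
    assert (Hv : forall x, vertex x E <-> x = u \/ x = p \/ x = v \/ vertex x E1).
    { intros x. split; intros Hx.
      - apply (vertex_perm _ _ _ HE) in Hx.
        rewrite (vertex_joins_cons _ _ _ _ _ H1), (vertex_joins_cons _ _ _ _ _ H2) in Hx. tauto.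
      - apply (vertex_perm _ _ _ (Permutation_sym HE)).
        rewrite (vertex_joins_cons _ _ _ _ _ H1), (vertex_joins_cons _ _ _ _ _ H2). tauto. }
    assert (Hv' : forall x, vertex x ((u, v) :: E1) <-> x = u \/ x = v \/ vertex x E1).
    { intros x. rewrite vertex_cons. simpl. tauto. }
    destruct (IH ((u, v) :: E1)) as (E' & G1 & G2 & G3 & G4 & G5).
    + apply Permutation_length in HE. simpl in *. lia.
    + eapply closed_perm; [|exact H4]. perm.
    + auto.
    + exists q. split; auto. rewrite vertex_app, Hv'. rewrite vertex_app, Hv in Hq.
      assert (q <> p) by (intros ->; tauto). tauto.
    + exists E'. repeat split; auto.
      * apply G2 in H. rewrite Hv' in H. rewrite Hv. tauto.
      * apply G2 in H. tauto.
      * intros x Hx Hxi. apply G3; auto. rewrite Hv in Hx. rewrite Hv'.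
        assert (x <> p) by (intros ->; tauto). tauto.
      * rewrite (esum_perm _ _ _ HE), !esum_cons in *.
        rewrite (ecost_joins _ _ _ H1), (ecost_joins _ _ _ H2).
        unfold ecost at 2 in G4. cbn [fst snd] in G4. pose proof (dist2_triangle u v p). lra.
      * intros P. specialize (G5 P). rewrite (esum_perm _ _ _ HE), !esum_cons in *.
        rewrite (touch_joins _ _ _ _ H1), (touch_joins _ _ _ _ H2).
        assert (touch P (u, v) <= touch P (u, p) + touch P (p, v)).
        { apply indic_le_or. simpl. tauto. }
        lra.
Qed.

(** Each point of [Q] is reached from [v] and left again by a double edge. No length is estimated,
    since these edges are rerouted along a chain afterwards. *)
Lemma closed_add_loops (Q : list point) (v : point) (E : list edge) :
  closed E -> vertex v E ->
  exists L, closed (L ++ E) /\ (forall q, In q Q -> vertex q L) /\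
    (forall p, vertex p L -> p = v \/ In p Q).
Proof.
  intros Hc Hv. induction Q as [|q Q (L & H1 & H2 & H3)].
  - exists []. repeat split; auto; [intros q []|]. intros p Hp. now apply vertex_nil in Hp.
  - exists ((v, q) :: (v, q) :: L). repeat split.
    + apply closed_add_loop; auto. apply vertex_app; auto.
    + intros x [->|Hx]; rewrite !vertex_cons; simpl; auto 6.
    + intros p. rewrite !vertex_cons. simpl. intros Hp.
      destruct Hp as [->|[->|[->|[->|Hp]]]]; auto. destruct (H3 p Hp); auto.
Qed.

Lemma vertex_list (E : list edge) : exists V : list point, forall p, In p V <-> vertex p E.
Proof.
  exists (flat_map (fun e : edge => [fst e; snd e]) E). intros p. rewrite in_flat_map.
  unfold vertex. split; intros (e & H1 & H2); exists e; simpl in *; intuition.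
Qed.

Lemma exists_max (f : point -> R) (V : list point) :
  V <> [] -> exists v, In v V /\ forall p, In p V -> f p <= f v.
Proof.
  induction V as [|a V IH]; [tauto|]. intros _.
  destruct V as [|b V].
  - exists a. split; [now left|]. intros p [->|[]]; lra.
  - destruct IH as (v & H1 & H2); [discriminate|].
    destruct (Rle_or_lt (f a) (f v)).
    + exists v. split; [now right|]. intros p [->|Hp]; auto.
    + exists a. split; [now left|]. intros p [->|Hp]; [lra|]. specialize (H2 p Hp). lra.
Qed.

Lemma exists_vertex_max (f : point -> R) (P : point -> Prop) (E : list edge) :
  (exists p, vertex p E /\ P p) ->
  exists v, vertex v E /\ P v /\ forall p, vertex p E -> P p -> f p <= f v.
Proof.
  intros (p & Hp & HP). destruct (vertex_list E) as (V & HV).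
  destruct (exists_max f (filter (fun p => decide (P p)) V)) as (v & H1 & H2).
  - intros H0. assert (Hin : In p (filter (fun p => decide (P p)) V)).
    { apply filter_In. rewrite HV. split; auto. unfold decide.
      now destruct (excluded_middle_informative (P p)). }
    rewrite H0 in Hin. destruct Hin.
  - apply filter_In in H1. destruct H1 as [H1 H3].
    exists v. rewrite <- HV. split; auto. split.
    + unfold decide in H3. now destruct (excluded_middle_informative (P v)).
    + intros x Hx HPx. apply H2. apply filter_In. rewrite HV. split; auto.
      unfold decide. now destruct (excluded_middle_informative (P x)).
Qed.

(** All vertical unit segments are considered, not only those of an instance, so that the surgery
    can be carried out without mentioning the instance. *)
Definition covers (E F : list edge) : Prop :=
  forall s p, vertex p E -> on_vseg s p -> exists q, vertex q F /\ on_vseg s q.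

Lemma permutation_split (P : edge -> Prop) (E : list edge) :
  exists A B, Permutation E (A ++ B) /\ (forall e, In e A -> P e) /\ (forall e, In e B -> ~ P e).
Proof.
  induction E as [|e E (A & B & H1 & H2 & H3)].
  - exists [], []. repeat split; auto; intros e [].
  - destruct (excluded_middle_informative (P e)) as [He|He].
    + exists (e :: A), B. repeat split; auto; [simpl; auto|]. intros a [->|Ha]; auto.
    + exists A, (e :: B). repeat split; auto; [perm|]. intros a [->|Ha]; auto.
Qed.

Lemma esum_perm_prefix_le (f : edge -> R) (E A B : list edge) :
  (forall e, 0 <= f e) -> Permutation E (A ++ B) -> esum f A <= esum f E.
Proof.
  intros Hf HP. rewrite (esum_perm _ _ _ HP), esum_app. pose proof (esum_nonneg f B Hf). lra.
Qed.

Lemma linked_joins (El : list edge) (e : edge) (u v : point) :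
  joins e u v -> linked El u v -> linked El (fst e) (snd e).
Proof. intros [->| ->] H; simpl; auto using linked_sym. Qed.

(* The constant 14 is [2 * (3 + 3 + 1)]: a vertical line meets at most three edges of each of the
   two chains and the common edge between them, and every edge is kept at most twice. *)
Lemma cell_surgery (E F : list edge) (h al c l r M : R) :
  al < l -> l <= r -> r < c ->
  closed (E ++ F) ->
  (forall p, vertex p E -> h <= snd p <= h + 1) ->
  (forall p, vertex p E -> (fst p = al \/ fst p = c) \/ l <= fst p <= r) ->
  (forall p, vertex p F -> ~ (al < fst p < c /\ h < snd p < h + 1)) ->
  esum (touch (fun p => fst p = al \/ fst p = c)) E <= M ->
  (exists p, vertex p E /\ l <= fst p <= r) ->
  exists E', closed (E' ++ F) /\
    (forall p, vertex p E' -> al <= fst p <= c /\ h <= snd p <= h + 1) /\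
    esum ecost E' <= esum ecost E + 5 * (r - l) /\ covers E E' /\
    (forall x0, esum (meets x0) E' <= M + 14).
Proof.
  intros Hal Hlr Hrc Hc Hstrip HEv HRv HM Hex.
  set (side := fun p : point => fst p = al \/ fst p = c) in *.
  set (mid := fun p : point => l <= fst p <= r).
  assert (Hsm : forall p, side p -> mid p -> False) by (unfold side, mid; intros; lra).
  (* The heights [ze] and [ga] of the highest and the lowest middle vertex are those of the two
     horizontal lines. *)
  destruct (exists_vertex_max snd mid E Hex) as (v0 & Hv0 & Hm0 & Hmax).
  destruct (exists_vertex_max (fun p => - snd p) mid E Hex) as (v1 & Hv1 & Hm1 & Hmin).
  cbv beta in Hmin. set (ze := snd v0) in *. set (ga := snd v1) in *.
  assert (Hrange : forall p, vertex p E -> mid p -> ga <= snd p <= ze).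
  { intros p Hp Hpm. pose proof (Hmax p Hp Hpm). pose proof (Hmin p Hp Hpm). lra. }
  assert (Hgz : ga <= ze) by (apply (Hrange v0); auto).
  assert (Hze : h <= ze <= h + 1) by now apply Hstrip.
  assert (Hga : h <= ga <= h + 1) by now apply Hstrip.
  destruct (vertex_list E) as (V & HV).
  set (Vm := filter (fun p => decide (mid p)) V).
  assert (HVm : forall p, In p Vm <-> vertex p E /\ mid p).
  { intros p. unfold Vm. rewrite filter_In, HV. unfold decide.
    destruct (excluded_middle_informative (mid p)); intuition; discriminate. }
  set (Zs := map fst Vm).
  assert (HZs : forall z, In z Zs -> l <= z <= r).
  { intros z Hz. apply in_map_iff in Hz. destruct Hz as (p & <- & Hp). now apply HVm in Hp. }
  assert (HZin : forall p, vertex p E -> mid p -> In (fst p) Zs).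
  { intros p Hp Hpm. apply in_map. now apply HVm. }
  (* Every middle vertex is projected to both lines, and the projections are visited by detours from
     [v0] and [v1], which lie on these lines. *)
  destruct (closed_add_loops (map (fun p => (fst p, ze)) Vm) v0 (E ++ F))
    as (Lt & Ht1 & Ht2 & Ht3); auto.
  { apply vertex_app; auto. }
  destruct (closed_add_loops (map (fun p => (fst p, ga)) Vm) v1 (Lt ++ E ++ F))
    as (Lb & Hb1 & Hb2 & Hb3); auto.
  { rewrite !vertex_app; auto. }
  assert (HLt : forall p, vertex p Lt -> In (fst p) Zs /\ snd p = ze).
  { intros p Hp. destruct (Ht3 p Hp) as [->|Hi]; [split; auto|].
    apply in_map_iff in Hi. destruct Hi as (q & <- & Hq). simpl. split; auto. now apply in_map. }
  assert (HLb : forall p, vertex p Lb -> In (fst p) Zs /\ snd p = ga).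
  { intros p Hp. destruct (Hb3 p Hp) as [->|Hi]; [split; auto|].
    apply in_map_iff in Hi. destruct Hi as (q & <- & Hq). simpl. split; auto. now apply in_map. }
  set (int := fun p : point => mid p /\ ga < snd p < ze).
  destruct (closed_eliminate int (length E) E (Lb ++ Lt ++ F))
    as (E2 & Hc2 & HV2 & HV2' & Hcost2 & Htouch2); auto.
  { eapply closed_perm; [|exact Hb1]. perm. }
  { intros p Hp [Hpm Hpi]. rewrite !vertex_app in Hp. destruct Hp as [Hp|[Hp|Hp]].
    - apply HLb in Hp. lra.
    - apply HLt in Hp. lra.
    - apply (HRv p Hp). unfold mid in Hpm. lra. }
  { exists v0. rewrite vertex_app. split; auto. unfold int. fold ze. lra. }
  specialize (Htouch2 side).
  (* The edges in [S] touch a side of the cell; there are at most [M] of them and they are kept.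
     After the elimination the edges in [N] have both ends on the two lines; they are divided into
     [TB], changing the line, and the horizontal ones. *)
  destruct (permutation_split (fun e => side (fst e) \/ side (snd e)) E2)
    as (S & N & HP1 & HS & HN).
  destruct (permutation_split (fun e => snd (fst e) <> snd (snd e)) N)
    as (TB & H & HP2 & HTB & HH).
  assert (HNv :
    forall p, vertex p N -> vertex p E /\ In (fst p) Zs /\ (snd p = ze \/ snd p = ga)).
  { intros p Hp. assert (Hp2 : vertex p E2).
    { apply (vertex_perm _ _ _ (Permutation_sym HP1)). apply vertex_app; auto. }
    apply HV2 in Hp2. destruct Hp2 as [HpE Hpi].
    assert (Hns : ~ side p).
    { destruct Hp as (e & He & Hpe). pose proof (HN e He) as Hne. simpl in Hne.
      intros Hs. apply Hne. destruct Hpe as [<-|<-]; auto. }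
    assert (Hpm : mid p) by (destruct (HEv p HpE); unfold side, mid in *; tauto).
    pose proof (Hrange p HpE Hpm). split; auto. split; auto.
    destruct (Req_dec (snd p) ze); auto. destruct (Req_dec (snd p) ga); auto.
    exfalso. apply Hpi. split; auto. lra. }
  destruct (horizontal_chain Zs ze l r HZs Hlr) as (Et & Et1 & Et2 & Et3 & Et4).
  destruct (horizontal_chain Zs ga l r HZs Hlr) as (Eb & Eb1 & Eb2 & Eb3 & Eb4).
  assert (Hline : forall X u v, In (fst u) Zs -> In (fst v) Zs -> snd u = snd v ->
    snd u = ze \/ snd u = ga -> linked (Et ++ Eb ++ X) u v).
  { intros X [ux uy] [vx vy] Hu Hv Huv Hy. simpl in *. subst vy.
    destruct Hy as [->| ->].
    - apply linked_incl with Et; auto using incl_appl, incl_refl.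
    - apply linked_incl with Eb; auto using incl_appl, incl_appr, incl_refl. }
  assert (HSmeet : forall x0, esum (meets x0) S <= M).
  { intros x0. apply Rle_trans with (esum (touch side) S).
    - apply esum_le. intros e He. unfold touch. rewrite (indic_true _ (HS e He)).
      apply meets_bounds.
    - apply Rle_trans with (esum (touch side) E2); [|lra].
      eapply esum_perm_prefix_le; [|exact HP1]. intros; apply indic_bounds. }
  (* [TB] holds the edges joining the two lines.  [K0] is the part of it that is kept, [TBx] the
     part that is rerouted, and [X] the common edge (if any) for passing between the lines. *)
  assert (Hgoal : forall K0 TBx X, Permutation TB (K0 ++ TBx) -> incl X TB ->
    (forall e, In e TBx -> linked (Et ++ Eb ++ X) (fst e) (snd e)) ->
    esum ecost K0 + 2 * esum ecost X <= esum ecost TB + (r - l) ->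
    (forall x0, esum (meets x0) K0 + 2 * esum (meets x0) X <= 2) ->
    exists E', closed (E' ++ F) /\
    (forall p, vertex p E' -> al <= fst p <= c /\ h <= snd p <= h + 1) /\
    esum ecost E' <= esum ecost E + 5 * (r - l) /\ covers E E' /\
    (forall x0, esum (meets x0) E' <= M + 14)).
  { intros K0 TBx X HP3 HX Hlink HcostX HmeetX.
    destruct (closed_reroute (Et ++ Eb ++ X) (TBx ++ H ++ Lt ++ Lb) (S ++ K0 ++ F))
      as (L & HL1 & HL2 & HL3).
    { eapply closed_perm; [|exact Hc2]. perm. }
    { intros e He. rewrite !in_app_iff in He. destruct He as [He|[He|[He|He]]]; auto.
      - assert (Hn : forall p, p = fst e \/ p = snd e -> vertex p N).
        { intros p Hp. apply (vertex_perm _ _ _ (Permutation_sym HP2)). apply vertex_app.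
          right. exists e; auto. }
        pose proof (HH e He) as Heq. simpl in Heq.
        destruct (HNv (fst e)) as (_ & A1 & A2); auto.
        destruct (HNv (snd e)) as (_ & B1 & B2); auto.
        apply Hline; auto. destruct (Req_dec (snd (fst e)) (snd (snd e))); tauto.
      - destruct (HLt (fst e)) as [A1 A2]; [exists e; auto|].
        destruct (HLt (snd e)) as [B1 B2]; [exists e; auto|].
        apply Hline; auto; congruence.
      - destruct (HLb (fst e)) as [A1 A2]; [exists e; auto|].
        destruct (HLb (snd e)) as [B1 B2]; [exists e; auto|].
        apply Hline; auto; congruence. }
    destruct (closed_reduce (Et ++ Eb ++ X) L (S ++ K0 ++ F) HL2 HL1) as (L' & G1 & G2 & G3 & G4).
    exists (S ++ K0 ++ L').
    assert (HNE2 :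
      forall p, vertex p E2 -> vertex p S \/ vertex p K0 \/ vertex p TBx \/ vertex p H).
    { intros p Hp. apply (vertex_perm _ _ _ HP1) in Hp. apply vertex_app in Hp.
      destruct Hp as [Hp|Hp]; auto. apply (vertex_perm _ _ _ HP2) in Hp. apply vertex_app in Hp.
      destruct Hp as [Hp|Hp]; auto. apply (vertex_perm _ _ _ HP3) in Hp. apply vertex_app in Hp.
      tauto. }
    assert (HTBv : forall p, vertex p TB -> vertex p E).
    { intros p Hp. apply HNv. apply (vertex_perm _ _ _ (Permutation_sym HP2)).
      apply vertex_app; auto. }
    assert (HboxE : forall p, vertex p E -> al <= fst p <= c /\ h <= snd p <= h + 1).
    { intros p Hp. split; auto. destruct (HEv p Hp) as [[->| ->]|?]; lra. }
    split; [|split; [|split; [|split]]].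
    - eapply closed_perm; [|exact G1]. perm.
    - intros p Hp. rewrite !vertex_app in Hp. destruct Hp as [Hp|[Hp|Hp]].
      + apply HboxE. apply HV2. apply (vertex_perm _ _ _ (Permutation_sym HP1)).
        apply vertex_app; auto.
      + apply HboxE, HTBv. apply (vertex_perm _ _ _ (Permutation_sym HP3)).
        apply vertex_app; auto.
      + apply (vertex_incl _ _ _ G3) in Hp. rewrite !vertex_app in Hp.
        destruct Hp as [Hp|[Hp|Hp]].
        * apply Et3 in Hp. destruct Hp as [-> Hp]. apply HZs in Hp. lra.
        * apply Eb3 in Hp. destruct Hp as [-> Hp]. apply HZs in Hp. lra.
        * apply HboxE, HTBv. now apply (vertex_incl _ _ _ HX).
    (* Both chains count twice, which accounts for [4 * (r - l)]; the fifth [r - l] comes from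
       [HcostX]. *)
    - specialize (G4 ecost ecost_nonneg).
      pose proof (esum_perm ecost _ _ HP1) as Q1. pose proof (esum_perm ecost _ _ HP2) as Q2.
      rewrite !esum_app in *. pose proof (esum_nonneg ecost H ecost_nonneg). lra.
    - intros s p Hp Hs.
      assert (Hvis :
        forall q, vertex q Lt \/ vertex q Lb \/ vertex q E2 -> vertex q (S ++ K0 ++ L')).
      { intros q Hq. rewrite !vertex_app.
        assert (Hq' : vertex q S \/ vertex q K0 \/ vertex q (TBx ++ H ++ Lt ++ Lb)).
        { rewrite !vertex_app. destruct Hq as [Hq|[Hq|Hq]]; auto 6.
          destruct (HNE2 q Hq); tauto. }
        destruct Hq' as [Hq'|[Hq'|Hq']]; auto. right; right.
        apply (vertex_incl _ _ _ G2). auto. }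
      destruct (HEv p Hp) as [Hps|Hpm].
      + exists p. split; auto. apply Hvis. right; right. apply HV2'; auto.
        intros [Hpm _]. eauto.
      + pose proof (Hrange p Hp Hpm). destruct Hs as [Hs1 Hs2].
        destruct (Rle_or_lt ze (snd s + 1)) as [Hle|Hlt].
        * exists (fst p, ze). split; [|split; simpl; auto; lra].
          apply Hvis. left. apply Ht2. apply (in_map (fun p : point => (fst p, ze))).
          now apply HVm.
        * exists (fst p, ga). split; [|split; simpl; auto; lra].
          apply Hvis. right; left. apply Hb2. apply (in_map (fun p : point => (fst p, ga))).
          now apply HVm.
    - intros x0. specialize (G4 (meets x0) (fun e => proj1 (meets_bounds x0 e))).
      specialize (HmeetX x0). specialize (HSmeet x0). specialize (Et2 x0). specialize (Eb2 x0).
      rewrite !esum_app in *. lra. }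
  assert (Hends : forall e, In e TB -> exists u v, joins e u v /\
    In (fst u) Zs /\ In (fst v) Zs /\ snd u = ze /\ snd v = ga).
  { intros e He. assert (Hn : forall p, p = fst e \/ p = snd e -> vertex p N).
    { intros p Hp. apply (vertex_perm _ _ _ (Permutation_sym HP2)). apply vertex_app.
      left. exists e; auto. }
    pose proof (HTB e He) as Hne. simpl in Hne.
    destruct (HNv (fst e)) as (_ & A1 & A2); auto.
    destruct (HNv (snd e)) as (_ & B1 & B2); auto.
    destruct A2 as [A2|A2], B2 as [B2|B2]; try congruence.
    - exists (fst e), (snd e). repeat split; auto. apply joins_self.
    - exists (snd e), (fst e). repeat split; auto. apply joins_sym, joins_self. }
  (* A single edge between the lines is kept as it is. If there are two or more, all of them are
     rerouted through [e1]. *)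
  destruct TB as [|e1 [|e2 TB]].
  - apply (Hgoal [] [] []); simpl; auto; try (intros; lra). apply incl_refl.
  - apply (Hgoal [e1] [] []); simpl; auto; try lra.
    + intros e [].
    + intros e [].
    + intros x0. pose proof (meets_bounds x0 e1). lra.
  - destruct (Hends e1) as (a & b & J1 & A1 & A2 & A3 & A4); [simpl; auto|].
    destruct (Hends e2) as (a' & b' & J2 & B1 & B2 & B3 & B4); [simpl; auto|].
    apply (Hgoal [] (e1 :: e2 :: TB) [e1]); simpl; auto.
    + intros e [<-|[]]; simpl; auto.
    + intros f Hf. destruct (Hends f Hf) as (u & v & J3 & C1 & C2 & C3 & C4).
      apply (linked_joins _ _ _ _ J3). apply linked_trans with a.
      { apply Hline; auto; congruence. }
      apply linked_trans with b.
      { assert (Hl : linked (Et ++ Eb ++ [e1]) (fst e1) (snd e1)).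
        { apply linked_edge. rewrite !in_app_iff. simpl; auto. }
        destruct J1 as [->| ->]; simpl in Hl; auto using linked_sym. }
      apply Hline; auto; congruence.
    (* The second copy of [e1] is paid for by [e2]: the former has length at most
       [(ze - ga) + (r - l)], the latter at least [ze - ga]. *)
    + pose proof (esum_nonneg ecost TB ecost_nonneg). unfold esum in *.
      rewrite (ecost_joins _ _ _ J1), (ecost_joins _ _ _ J2).
      pose proof (dist2_le_taxicab a b) as D1. pose proof (dist2_ge_snd a' b') as D2.
      rewrite A3, A4 in D1. rewrite B3, B4 in D2. rewrite (Rabs_right (ze - ga)) in * by lra.
      apply HZs in A1, A2.
      assert (Rabs (fst a - fst b) <= r - l) by (apply Rabs_le; lra). lra.
    + intros x0. pose proof (meets_bounds x0 e1). lra.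
Qed.

(** * Surgery in a strip *)

(** This allows the same cutting lemmas for vertical cuts, with [fst], and for horizontal cuts, with
    [snd]. *)
Definition affine (f : point -> R) : Prop :=
  forall u v lam, f (lerp u v lam) = f u + lam * (f v - f u).

Lemma affine_fst : affine fst.
Proof. intros u v lam. reflexivity. Qed.

Lemma affine_snd : affine snd.
Proof. intros u v lam. reflexivity. Qed.

Definition level_point (f : point -> R) (c : R) (u v : point) : point :=
  lerp u v ((c - f u) / (f v - f u)).

(** A vertex at level [c] counts as low, so an edge that rises from level [c] leaves a degenerate
    edge in the low part. The low part of a split edge is directed towards the cut point. *)
Definition cut_low (f : point -> R) (c : R) (e : edge) : list edge :=
  let (u, v) := e in
  if Rle_dec (f u) c
  then if Rle_dec (f v) c then [e] else [(u, level_point f c u v)]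
  else if Rle_dec (f v) c then [(v, level_point f c v u)] else [].

Definition cut_high (f : point -> R) (c : R) (e : edge) : list edge :=
  let (u, v) := e in
  if Rle_dec (f u) c
  then if Rle_dec (f v) c then [] else [(level_point f c u v, v)]
  else if Rle_dec (f v) c then [(level_point f c v u, u)] else [e].

Inductive cut_spec (f : point -> R) (c : R) (e : edge) : list edge -> list edge -> Prop :=
| cut_spec_low : f (fst e) <= c -> f (snd e) <= c -> cut_spec f c e [e] []
| cut_spec_high : c < f (fst e) -> c < f (snd e) -> cut_spec f c e [] [e]
| cut_spec_split u v w lam : joins e u v -> f u <= c < f v -> f w = c ->
    0 <= lam <= 1 -> w = lerp u v lam -> cut_spec f c e [(u, w)] [(w, v)].

Lemma level_point_spec (f : point -> R) (c : R) (Hf : affine f) (u v : point) :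
  f u <= c < f v ->
  f (level_point f c u v) = c /\ 0 <= (c - f u) / (f v - f u) <= 1.
Proof.
  intros H. split.
  - unfold level_point. rewrite Hf. field. lra.
  - assert (0 < / (f v - f u)) by (apply Rinv_0_lt_compat; lra). split.
    + unfold Rdiv. apply Rmult_le_pos; lra.
    + apply Rmult_le_reg_r with (f v - f u); [lra|]. unfold Rdiv.
      rewrite Rmult_assoc, Rinv_l; lra.
Qed.

Lemma cutP (f : point -> R) (c : R) (Hf : affine f) (e : edge) :
  cut_spec f c e (cut_low f c e) (cut_high f c e).
Proof.
  destruct e as [u v]. unfold cut_low, cut_high.
  destruct (Rle_dec (f u) c) as [Hu|Hu], (Rle_dec (f v) c) as [Hv|Hv].
  - now constructor.
  - destruct (level_point_spec f c Hf u v) as [H1 H2]; [lra|].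
    econstructor; eauto; [now left|lra].
  - destruct (level_point_spec f c Hf v u) as [H1 H2]; [lra|].
    econstructor; eauto; [now right|lra].
  - constructor; simpl; lra.
Qed.

(** A split edge is replaced by the walk of two edges through its cut point. *)
Lemma cut_closed (f : point -> R) (c : R) (Hf : affine f) (E F : list edge) :
  closed (E ++ F) -> closed (flat_map (cut_low f c) E ++ flat_map (cut_high f c) E ++ F).
Proof.
  revert F. induction E as [|e E IH]; intros F Hc; auto.
  cbn [flat_map].
  assert (H : closed (E ++ cut_low f c e ++ cut_high f c e ++ F)).
  { destruct (cutP f c Hf e) as [H1 H2|H1 H2|u v w lam H1 H2 H3 H4 H5].
    - eapply closed_perm; [|exact Hc]. simpl. perm.
    - eapply closed_perm; [|exact Hc]. simpl. perm.
    - apply closed_perm with ([(u, w); (w, v)] ++ E ++ F); [perm|].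
      apply closed_subst with u v e; auto.
      apply walk_cons with w; [now left|]. apply walk_edge. now left. }
  apply IH in H. eapply closed_perm; [|exact H]. perm.
Qed.

Lemma cut_cost (f : point -> R) (c : R) (Hf : affine f) (E : list edge) :
  esum ecost (flat_map (cut_low f c) E) + esum ecost (flat_map (cut_high f c) E) = esum ecost E.
Proof.
  induction E as [|e E IH]; [simpl; lra|].
  cbn [flat_map]. rewrite !esum_app, esum_cons, <- IH.
  destruct (cutP f c Hf e) as [H1 H2|H1 H2|u v w lam H1 H2 H3 H4 H5]; simpl; try lra.
  rewrite (ecost_joins _ _ _ H1), H5. unfold ecost; simpl.
  pose proof (dist2_lerp u v lam H4). lra.
Qed.

Lemma vertex_flat_map (k : edge -> list edge) (E : list edge) (p : point) :
  vertex p (flat_map k E) <-> exists e, In e E /\ vertex p (k e).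
Proof.
  unfold vertex. split.
  - intros (e' & He' & Hp). apply in_flat_map in He'. destruct He' as (e & He & Hk). eauto.
  - intros (e & He & e' & He' & Hp). exists e'. split; auto. apply in_flat_map. eauto.
Qed.

Lemma cut_vertex_edge (f : point -> R) (c : R) (Hf : affine f) (e : edge) (p : point) :
  p = fst e \/ p = snd e -> vertex p (cut_low f c e) \/ vertex p (cut_high f c e).
Proof.
  destruct (cutP f c Hf e) as [H1 H2|H1 H2|u v w lam H1 H2 H3 H4 H5]; rewrite ?vertex_cons;
    intros Hp.
  - tauto.
  - tauto.
  - destruct H1 as [->| ->]; simpl in *; tauto.
Qed.

Lemma cut_vertex (f : point -> R) (c : R) (Hf : affine f) (E : list edge) (p : point) :
  vertex p E -> vertex p (flat_map (cut_low f c) E) \/ vertex p (flat_map (cut_high f c) E).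
Proof.
  intros (e & He & Hp). rewrite !vertex_flat_map.
  destruct (cut_vertex_edge f c Hf e p Hp); eauto.
Qed.

Lemma cut_low_vertex (f : point -> R) (c : R) (Hf : affine f) (E : list edge) (p : point) :
  vertex p (flat_map (cut_low f c) E) -> f p <= c /\ (vertex p E \/ f p = c).
Proof.
  rewrite vertex_flat_map. intros (e & He & Hp).
  assert (HE : p = fst e \/ p = snd e -> vertex p E) by (intros H; exists e; auto).
  destruct (cutP f c Hf e) as [H1 H2|H1 H2|u v w lam H1 H2 H3 H4 H5];
    rewrite ?vertex_cons in Hp; simpl in Hp.
  - destruct Hp as [->|[->|Hp]]; auto. now apply vertex_nil in Hp.
  - now apply vertex_nil in Hp.
  - destruct Hp as [->|[->|Hp]].
    + split; [lra|]. left. apply HE. destruct H1 as [->| ->]; simpl; auto.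
    + split; [lra|auto].
    + now apply vertex_nil in Hp.
Qed.

Lemma cut_high_vertex (f : point -> R) (c : R) (Hf : affine f) (E : list edge) (p : point) :
  vertex p (flat_map (cut_high f c) E) -> c <= f p /\ (vertex p E \/ f p = c).
Proof.
  rewrite vertex_flat_map. intros (e & He & Hp).
  assert (HE : p = fst e \/ p = snd e -> vertex p E) by (intros H; exists e; auto).
  destruct (cutP f c Hf e) as [H1 H2|H1 H2|u v w lam H1 H2 H3 H4 H5];
    rewrite ?vertex_cons in Hp; simpl in Hp.
  - now apply vertex_nil in Hp.
  - destruct Hp as [->|[->|Hp]]; [split; auto; lra..|]. now apply vertex_nil in Hp.
  - destruct Hp as [->|[->|Hp]].
    + split; [lra|auto].
    + split; [lra|]. left. apply HE. destruct H1 as [->| ->]; simpl; auto.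
    + now apply vertex_nil in Hp.
Qed.

Lemma cut_convex (f : point -> R) (c : R) (Hf : affine f) (P : point -> Prop) (E : list edge) :
  (forall u v lam, 0 <= lam <= 1 -> P u -> P v -> P (lerp u v lam)) ->
  (forall p, vertex p E -> P p) ->
  forall p, vertex p (flat_map (cut_low f c) E) \/ vertex p (flat_map (cut_high f c) E) -> P p.
Proof.
  intros HP HE p Hp. rewrite !vertex_flat_map in Hp.
  assert (Hk : exists e, In e E /\ (vertex p (cut_low f c e) \/ vertex p (cut_high f c e))).
  { destruct Hp as [(e & H1 & H2)|(e & H1 & H2)]; eauto. }
  destruct Hk as (e & He & Hv).
  assert (H1 : P (fst e)) by (apply HE; exists e; auto).
  assert (H2 : P (snd e)) by (apply HE; exists e; auto).
  destruct (cutP f c Hf e) as [G1 G2|G1 G2|u v w lam G1 G2 G3 G4 G5].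
  - destruct Hv as [Hv|Hv]; [|now apply vertex_nil in Hv].
    apply vertex_cons in Hv. destruct Hv as [->|[->|Hv]]; auto. now apply vertex_nil in Hv.
  - destruct Hv as [Hv|Hv]; [now apply vertex_nil in Hv|].
    apply vertex_cons in Hv. destruct Hv as [->|[->|Hv]]; auto. now apply vertex_nil in Hv.
  - assert (Pu : P u) by (destruct G1 as [->| ->]; auto).
    assert (Pv : P v) by (destruct G1 as [->| ->]; auto).
    assert (Pw : P w) by (rewrite G5; auto).
    destruct Hv as [Hv|Hv]; apply vertex_cons in Hv; simpl in Hv;
      destruct Hv as [->|[->|Hv]]; auto; now apply vertex_nil in Hv.
Qed.

Lemma esum_plus (f g : edge -> R) (E : list edge) :
  esum (fun e => f e + g e) E = esum f E + esum g E.
Proof. induction E as [|e E IH]; [simpl; lra|]. rewrite !esum_cons, IH. lra. Qed.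

Lemma esum_scal (k : R) (f : edge -> R) (E : list edge) :
  esum (fun e => k * f e) E = k * esum f E.
Proof. induction E as [|e E IH]; [simpl; lra|]. rewrite !esum_cons, IH. lra. Qed.

Lemma esum_le_strict (f g : edge -> R) (k : R) (e : edge) (E : list edge) :
  (forall a, In a E -> f a <= g a) -> In e E -> f e + k <= g e ->
  esum f E + k <= esum g E.
Proof.
  intros H Hin He. apply in_split in Hin. destruct Hin as (l1 & l2 & ->).
  rewrite !esum_app, !esum_cons.
  assert (esum f l1 <= esum g l1) by (apply esum_le; intros; apply H, in_app_iff; auto).
  assert (esum f l2 <= esum g l2) by (apply esum_le; intros; apply H, in_app_iff; simpl; auto).
  lra.
Qed.

(** * Light cuts and the sweep through a strip *)

Definition right_ends (x : R) (e : edge) : R :=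
  indic (x < fst (fst e)) + indic (x < fst (snd e)).

Lemma right_ends_nonneg (x : R) (e : edge) : 0 <= right_ends x e.
Proof.
  unfold right_ends. pose proof (indic_bounds (x < fst (fst e))).
  pose proof (indic_bounds (x < fst (snd e))). lra.
Qed.

(** The number of edge ends to the right of an abscissa is the measure for sweeping from left to
    right: it drops whenever the sweep passes a vertex. *)
Lemma right_ends_decr (x y : R) (p : point) (E : list edge) :
  x < fst p <= y -> vertex p E -> esum (right_ends y) E + 1 <= esum (right_ends x) E.
Proof.
  intros Hxy (e & He & Hp).
  assert (Hle : forall z : R, indic (y < z) <= indic (x < z)) by (intros; apply indic_le; lra).
  apply esum_le_strict with e; auto.
  - intros a _. unfold right_ends.
    pose proof (Hle (fst (fst a))); pose proof (Hle (fst (snd a))). lra.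
  - unfold right_ends.
    destruct Hp as [<-|<-]; rewrite (indic_false (y < fst p)), (indic_true (x < fst p)) by lra.
    + pose proof (Hle (fst (snd e))). lra.
    + pose proof (Hle (fst (fst e))). lra.
Qed.

(** The inequalities are strict, in contrast to [meets]: an edge that ends at [c] is not divided by
    a cut there. *)
Definition crosses (c : R) (e : edge) : R :=
  indic (fst (fst e) < c < fst (snd e) \/ fst (snd e) < c < fst (fst e)).

Definition clamp (a b t : R) : R :=
  if Rle_lt_dec t a then a else if Rle_lt_dec b t then b else t.

(** For [a <= b] this is the length of the part of the horizontal projection of the edge inside
    [[a, b]]. *)
Definition clip (a b : R) (e : edge) : R :=
  Rabs (clamp a b (fst (snd e)) - clamp a b (fst (fst e))).

Ltac clamps := unfold clamp;
  repeat match goal with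
    | |- context [Rle_lt_dec ?a ?b] => destruct (Rle_lt_dec a b)
  end; try lra.

Lemma clip_add (a b c : R) (e : edge) :
  a <= b <= c -> clip a b e + clip b c e <= clip a c e.
Proof.
  intros H. unfold clip. destruct e as [[u u'] [v v']]; cbn [fst snd].
  destruct (Rle_or_lt u v).
  - rewrite !Rabs_right; clamps.
  - rewrite !Rabs_left1; clamps.
Qed.

Lemma clip_le_dist (a b : R) (e : edge) : a <= b -> clip a b e <= ecost e.
Proof.
  intros H. unfold ecost. pose proof (dist2_ge_fst (fst e) (snd e)) as Hd.
  destruct e as [[u u'] [v v']]; cbn [fst snd] in *.
  apply Rle_trans with (Rabs (u - v)); auto. clear Hd.
  unfold clip; cbn [fst snd]. destruct (Rle_or_lt u v).
  - rewrite Rabs_right, Rabs_left1; clamps.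
  - rewrite Rabs_left1, Rabs_right; clamps.
Qed.

(** The gaps between consecutive vertex abscissas are scanned from [x] to the right until one is
    light. Each heavy gap passed is spanned by more than [K] edges, so [K] times its length is at
    most the projected length of [E] over it. *)
Lemma light_gap (E : list edge) (K : R) (n : nat) (x : R) :
  0 <= K -> esum (right_ends x) E <= INR n ->
  exists r c, x <= r < c /\ (forall p, vertex p E -> fst p <= r \/ c < fst p) /\
    esum (crosses c) E <= K /\ K * (r - x) <= esum (clip x r) E.
Proof.
  intros HK. revert x. induction n as [|n IH]; intros x Hn.
  all: destruct (excluded_middle_informative (exists p, vertex p E /\ x < fst p)) as [Hex|Hno].
  (* Beyond the last vertex nothing crosses, so any cut to the right of [x] is light. *)
  2, 4: exists x, (x + 1); repeat split; try lra;
    [ intros p Hp; destruct (Rle_or_lt (fst p) x); [auto|exfalso; eauto]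
    | rewrite esum_zero; auto; intros e He; apply indic_false;
      assert (H1 : vertex (fst e) E) by (exists e; auto);
      assert (H2 : vertex (snd e) E) by (exists e; auto);
      intros [H|H]; apply Hno; [exists (snd e)|exists (fst e)]; split; auto; lra
    | rewrite Rminus_diag, Rmult_0_r; apply esum_nonneg; intros; apply Rabs_pos ].
  - exfalso. destruct Hex as (p & Hp & Hx).
    pose proof (right_ends_decr x (fst p) p E ltac:(lra) Hp) as Hd. simpl in Hn.
    pose proof (esum_nonneg _ E (right_ends_nonneg (fst p))). lra.
  - destruct (exists_vertex_max (fun p => - fst p) (fun p => x < fst p) E Hex)
      as (q & Hq & Hxq & Hmin). cbv beta in Hmin. set (y := fst q) in *.
    assert (Hgap : forall p, vertex p E -> fst p <= x \/ y <= fst p).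
    { intros p Hp. destruct (Rle_or_lt (fst p) x) as [?|Hlt]; auto.
      right. pose proof (Hmin p Hp Hlt). lra. }
    (* No vertex lies strictly between [x] and [y], so the midpoint decides for the whole gap. *)
    set (c := (x + y) / 2).
    destruct (Rle_or_lt (esum (crosses c) E) K) as [Hl|Hh].
    + exists x, c. unfold c in *. repeat split; try lra.
      * intros p Hp. destruct (Hgap p Hp); lra.
      * rewrite Rminus_diag, Rmult_0_r; apply esum_nonneg; intros; apply Rabs_pos.
    + destruct (IH y) as (r & c' & H1 & H2 & H3 & H4).
      { rewrite S_INR in Hn. pose proof (right_ends_decr x y q E ltac:(unfold y in *; lra) Hq).
        lra. }
      exists r, c'. repeat split; auto; try lra.
      assert (Hxy : K * (y - x) <= esum (clip x y) E).
      { apply Rle_trans with ((y - x) * esum (crosses c) E); [nra|].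
        rewrite <- esum_scal. apply esum_le. intros e He.
        assert (V1 := Hgap (fst e) (ex_intro _ e (conj He (or_introl eq_refl)))).
        assert (V2 := Hgap (snd e) (ex_intro _ e (conj He (or_intror eq_refl)))).
        unfold crosses. unfold indic.
        destruct (excluded_middle_informative _) as [Hcr|Hcr].
        - destruct e as [[u u'] [v v']]; cbn [fst snd] in *. unfold c in Hcr. unfold clip.
          cbn [fst snd].
          destruct Hcr as [Hcr|Hcr].
          + rewrite Rabs_right; clamps.
          + rewrite Rabs_left1; clamps.
        - rewrite Rmult_0_r. apply Rabs_pos. }
      assert (esum (clip x y) E + esum (clip y r) E <= esum (clip x r) E).
      { rewrite <- esum_plus. apply esum_le. intros e _. apply clip_add. lra. }
      lra.
Qed.

Lemma covers_cut (f : point -> R) (c : R) (E EL EH : list edge) :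
  affine f -> covers (flat_map (cut_low f c) E) EL -> covers (flat_map (cut_high f c) E) EH ->
  covers E (EL ++ EH).
Proof.
  intros Hf HL HH s p Hp Hs. destruct (cut_vertex f c Hf E p Hp) as [H|H].
  - destruct (HL s p H Hs) as (q & Hq & Hqs). exists q. rewrite vertex_app; auto.
  - destruct (HH s p H Hs) as (q & Hq & Hqs). exists q. rewrite vertex_app; auto.
Qed.

(** The abscissa [al] is the last light cut and [F] is everything outside the rest of the strip. The
    next cell starts at the first vertex [l] right of [al] and extends over heavy gaps to [r]; a
    light cut [c] follows. The cell is treated with [M = 2 * K], one [K] for each of its cuts, and
    the sweep goes on from [c]. Only at a cut can a vertical line meet two cells, which doubles
    [2 * K + 14]; the separate bound for [x0 <= al] excludes a third. *)
Lemma strip_surgery (h K : R) (n : nat) (E F : list edge) (al : R) :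
  0 < K -> esum (right_ends al) E <= INR n -> closed (E ++ F) ->
  (forall p, vertex p E -> al <= fst p /\ h <= snd p <= h + 1) ->
  (forall p, vertex p F -> ~ (al < fst p /\ h < snd p < h + 1)) ->
  esum (touch (fun p => fst p = al)) E <= K ->
  exists E', closed (E' ++ F) /\
    (forall p, vertex p E' -> al <= fst p /\ h <= snd p <= h + 1) /\
    esum ecost E' <= (1 + 5 / K) * esum ecost E /\ covers E E' /\
    (forall x0, esum (meets x0) E' <= 4 * K + 28 /\
       (x0 <= al -> esum (meets x0) E' <= 2 * K + 14)).
Proof.
  intros HK. revert E F al. induction n as [|n IH]; intros E F al Hn Hc HE HF Ht.
  all: destruct (excluded_middle_informative (exists p, vertex p E /\ al < fst p)) as [Hex|Hno].
  (* Without vertices right of [al], every edge touches the cut at [al], so that [Ht] already bounds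
     their number and nothing is changed. *)
  2, 4: exists E; split; [auto|]; split; [auto|]; split; [|split];
    [ pose proof (esum_nonneg ecost E ecost_nonneg);
      assert (0 <= 5 / K * esum ecost E); [|lra];
      apply Rmult_le_pos; auto; apply Rlt_le, Rdiv_lt_0_compat; lra
    | intros s p Hp Hs; eauto
    | intros x0; assert (esum (meets x0) E <= esum (touch (fun p => fst p = al)) E); [|lra];
      apply esum_le; intros e He; unfold touch; rewrite indic_true; [apply meets_bounds|];
      left; assert (V1 : vertex (fst e) E) by (exists e; auto);
      destruct (Rle_or_lt (fst (fst e)) al); [pose proof (proj1 (HE _ V1)); lra|];
      exfalso; eauto ].
  - exfalso. destruct Hex as (p & Hp & Hx).
    pose proof (right_ends_decr al (fst p) p E ltac:(lra) Hp) as Hd. simpl in Hn.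
    pose proof (esum_nonneg _ E (right_ends_nonneg (fst p))). lra.
  - destruct (exists_vertex_max (fun p => - fst p) (fun p => al < fst p) E Hex)
      as (p1 & Hp1 & Hx1 & Hmin). cbv beta in Hmin. set (l := fst p1) in *.
    assert (Hl : forall p, vertex p E -> fst p = al \/ l <= fst p).
    { intros p Hp. destruct (HE p Hp) as [H1 _]. destruct (Rle_or_lt (fst p) al) as [?|Hlt].
      - left; lra.
      - right. pose proof (Hmin p Hp Hlt). lra. }
    pose proof (right_ends_decr al l p1 E ltac:(unfold l in *; lra) Hp1) as Hdec.
    destruct (light_gap E K (S n) l) as (r & c & Hlrc & Hgap & Hcross & Hclip); [lra|lra|].
    set (EL := flat_map (cut_low fst c) E). set (EH := flat_map (cut_high fst c) E).
    pose proof (cut_closed fst c affine_fst E F Hc) as Hcut. fold EL EH in Hcut.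
    pose proof (cut_cost fst c affine_fst E) as Hcost. fold EL EH in Hcost.
    assert (Hbox : forall p, vertex p EL \/ vertex p EH -> al <= fst p /\ h <= snd p <= h + 1).
    { apply (cut_convex fst c affine_fst (fun p => al <= fst p /\ h <= snd p <= h + 1)); auto.
      intros u v lam Hlam Hu Hv. simpl. nra. }
    assert (HEL : forall p, vertex p EL -> fst p <= c /\ (vertex p E \/ fst p = c))
      by (apply cut_low_vertex, affine_fst).
    assert (HEH : forall p, vertex p EH -> c <= fst p /\ (vertex p E \/ fst p = c))
      by (apply cut_high_vertex, affine_fst).
    assert (Hnc : forall p, vertex p E -> fst p <> c).
    { intros p Hp He. destruct (Hgap p Hp); lra. }
    assert (HinE : forall e, In e E -> vertex (fst e) E /\ vertex (snd e) E).
    { intros e He. split; exists e; auto. }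
    assert (Hjoin : forall e u v, In e E -> joins e u v -> vertex u E /\ vertex v E).
    { intros e u v He [->| ->]; apply HinE in He; simpl in He; tauto. }
    assert (HcrossJ : forall e u v, joins e u v -> fst u < c < fst v -> crosses c e = 1).
    { intros e u v [->| ->] Huv; apply indic_true; simpl; lra. }
    (* As [r < c], high edges have no projection on [[l, r]], and a split edge loses none of it when
       reduced to its low part. *)
    assert (HclipL : esum (clip l r) E <= esum ecost EL).
    { apply esum_flat_map_ge. intros e He.
      destruct (cutP fst c affine_fst e) as [H1 H2|H1 H2|u v w lam H1 H2 H3 H4 H5].
      - cbn. rewrite Rplus_0_r. apply clip_le_dist. lra.
      - cbn. apply Req_le. unfold clip.
        replace (_ - _) with 0 by clamps. apply Rabs_R0.
      - rewrite esum_cons. cbn [esum fold_right]. rewrite Rplus_0_r.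
        apply Rle_trans with (clip l r (u, w)); [|apply clip_le_dist; lra].
        assert (Hw : clamp l r (fst w) = clamp l r (fst v)) by (rewrite H3; clamps).
        unfold clip. cbn [fst snd]. rewrite Hw.
        destruct H1 as [->| ->]; cbn [fst snd]; [lra|]. rewrite Rabs_minus_sym. lra. }
    assert (HtL : esum (touch (fun p => fst p = al)) EL <= K).
    { apply Rle_trans with (esum (touch (fun p => fst p = al)) E); auto.
      apply esum_flat_map. intros e He.
      destruct (cutP fst c affine_fst e) as [H1 H2|H1 H2|u v w lam H1 H2 H3 H4 H5].
      - cbn. lra.
      - cbn. apply indic_bounds.
      - cbn. rewrite Rplus_0_r, (touch_joins _ _ _ _ H1).
        apply indic_le. cbn [fst snd]. intros [?|?]; [auto|]. exfalso. unfold l in *. lra. }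
    (* No vertex of [E] has abscissa [c], so only cut points lie there, one for each crossing
       edge. *)
    assert (HtcL : esum (touch (fun p => fst p = c)) EL <= K).
    { apply Rle_trans with (esum (crosses c) E); auto.
      apply esum_flat_map. intros e He.
      destruct (cutP fst c affine_fst e) as [H1 H2|H1 H2|u v w lam H1 H2 H3 H4 H5].
      - cbn. rewrite Rplus_0_r. unfold touch. rewrite indic_false; [apply indic_bounds|].
        intros [H|H]; [apply (Hnc (fst e))|apply (Hnc (snd e))]; auto; now apply HinE.
      - cbn. apply indic_bounds.
      - cbn. rewrite Rplus_0_r. rewrite (HcrossJ _ _ _ H1); [apply indic_bounds|].
        pose proof (Hnc u (proj1 (Hjoin _ _ _ He H1))). lra. }
    assert (HtcH : esum (touch (fun p => fst p = c)) EH <= K).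
    { apply Rle_trans with (esum (crosses c) E); auto.
      apply esum_flat_map. intros e He.
      destruct (cutP fst c affine_fst e) as [H1 H2|H1 H2|u v w lam H1 H2 H3 H4 H5].
      - cbn. apply indic_bounds.
      - cbn. rewrite Rplus_0_r. unfold touch. rewrite indic_false; [apply indic_bounds|].
        intros [H|H]; [apply (Hnc (fst e))|apply (Hnc (snd e))]; auto; now apply HinE.
      - cbn. rewrite Rplus_0_r. rewrite (HcrossJ _ _ _ H1); [apply indic_bounds|].
        pose proof (Hnc u (proj1 (Hjoin _ _ _ He H1))). lra. }
    (* Cut points have abscissa exactly [c] and do not count; passing [p1] has lowered the
       measure. *)
    assert (HrH : esum (right_ends c) EH <= INR n).
    { apply Rle_trans with (esum (right_ends l) E); [|rewrite S_INR in Hn; lra].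
      apply esum_flat_map. intros e He.
      assert (Hmono : forall z :
        R, indic (c < z) <= indic (l < z)) by (intros; apply indic_le; lra).
      destruct (cutP fst c affine_fst e) as [H1 H2|H1 H2|u v w lam H1 H2 H3 H4 H5].
      - cbn. pose proof (indic_bounds (l < fst (fst e))).
        pose proof (indic_bounds (l < fst (snd e))). unfold right_ends. lra.
      - cbn. unfold right_ends. pose proof (Hmono (fst (fst e))).
        pose proof (Hmono (fst (snd e))). lra.
      - cbn. unfold right_ends at 1. cbn [fst snd]. rewrite (indic_false (c < fst w)) by lra.
        pose proof (Hmono (fst v)).
        assert (indic (l < fst v) <= right_ends l e).
        { unfold right_ends. pose proof (indic_bounds (l < fst u)).
          destruct H1 as [->| ->]; cbn [fst snd]; lra. }
        lra. }
    destruct (cell_surgery EL (EH ++ F) h al c l r (2 * K)) as (EL' & A1 & A2 & A3 & A4 & A5);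
      try lra; auto.
    { intros p Hp. apply Hbox; auto. }
    { intros p Hp. destruct (HEL p Hp) as [Hpc [HpE|HpE]]; [|auto].
      destruct (Hl p HpE) as [?|?]; [auto|]. destruct (Hgap p HpE); [right; lra|lra]. }
    { intros p Hp [H1 H2]. apply vertex_app in Hp. destruct Hp as [Hp|Hp].
      - apply HEH in Hp. lra.
      - apply (HF p Hp). lra. }
    { apply Rle_trans
        with (esum (fun e => touch (fun p => fst p = al) e + touch (fun p => fst p = c) e) EL).
      - apply esum_le. intros e _. apply indic_le_or. tauto.
      - rewrite esum_plus. lra. }
    { exists p1. split; [|fold l; lra].
      destruct (cut_vertex fst c affine_fst E p1 Hp1) as [H|H]; auto.
      exfalso. apply HEH in H. fold l in H. lra. }
    destruct (IH EH (EL' ++ F) c) as (EH' & B1 & B2 & B3 & B4 & B5); auto.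
    { eapply closed_perm; [|exact A1]. perm. }
    { intros p Hp. split; [now apply HEH|]. apply Hbox; auto. }
    { intros p Hp [H1 H2]. apply vertex_app in Hp. destruct Hp as [Hp|Hp].
      - apply A2 in Hp. lra.
      - apply (HF p Hp). unfold l in *. lra. }
    exists (EL' ++ EH'). split; [|split; [|split; [|split]]].
    + eapply closed_perm; [|exact B1]. perm.
    + intros p Hp. apply vertex_app in Hp. destruct Hp as [Hp|Hp].
      * apply A2 in Hp. lra.
      * apply B2 in Hp. unfold l in *. lra.
    + rewrite esum_app, <- Hcost.
      (* The heavy length is charged to the edges of this cell only, so that the charges of
         different cells add up. *)
      assert (Hw : 5 * (r - l) <= 5 / K * esum ecost EL).
      { apply Rmult_le_reg_l with K; auto. unfold Rdiv.
        replace (K * (5 * / K * esum ecost EL)) with (5 * esum ecost EL) by (field; lra). lra. }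
      lra.
    + now apply covers_cut with fst c; [apply affine_fst| |].
    + intros x0. rewrite esum_app. specialize (A5 x0). destruct (B5 x0) as [B6 B7].
      destruct (Rle_or_lt x0 c) as [Hx|Hx].
      * specialize (B7 Hx). split; [lra|]. intros Hxa.
        rewrite (esum_meets_zero x0 EH'); [lra|]. left. intros p Hp. apply B2 in Hp.
        unfold l in *. lra.
      * rewrite (esum_meets_zero x0 EL'); [split; [lra|]|].
        -- intros. unfold l in *. lra.
        -- right. intros p Hp. apply A2 in Hp. lra.
Qed.

(** The sweep starts left of all vertices, where no edge touches the initial cut. *)
Lemma whole_strip_surgery (h K : R) (E F : list edge) :
  0 < K -> closed (E ++ F) ->
  (forall p, vertex p E -> h <= snd p <= h + 1) ->
  (forall p, vertex p F -> ~ (h < snd p < h + 1)) ->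
  exists E', closed (E' ++ F) /\
    (forall p, vertex p E' -> h <= snd p <= h + 1) /\
    esum ecost E' <= (1 + 5 / K) * esum ecost E /\ covers E E' /\
    (forall x0, esum (meets x0) E' <= 4 * K + 28).
Proof.
  intros HK Hc HE HF.
  assert (Hal : exists al, forall p, vertex p E -> al < fst p).
  { destruct (excluded_middle_informative (exists p, vertex p E /\ True)) as [Hex|Hno].
    - destruct (exists_vertex_max (fun p => - fst p) (fun _ => True) E Hex) as (v & _ & _ & Hv).
      exists (fst v - 1). intros p Hp. specialize (Hv p Hp I). simpl in Hv. lra.
    - exists 0. intros p Hp. exfalso. eauto. }
  destruct Hal as (al & Hal). destruct (INR_unbounded (esum (right_ends al) E)) as (n & Hn).
  destruct (strip_surgery h K n E F al) as (E' & H1 & H2 & H3 & H4 & H5); auto; try lra.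
  - intros p Hp. specialize (Hal p Hp). split; auto; lra.
  - intros p Hp [_ H]. now apply (HF p).
  - rewrite esum_zero; [lra|]. intros e He. apply indic_false.
    assert (al < fst (fst e)) by (apply Hal; exists e; auto).
    assert (al < fst (snd e)) by (apply Hal; exists e; auto). lra.
  - exists E'. repeat split; auto; try (now apply H2); intros; apply H5.
Qed.

(** * Stacking the strips *)

Definition window_meets (a x0 : R) (e : edge) : R := indic (piece_meets a x0 e).

Lemma window_meets_le (a x0 : R) (e : edge) : window_meets a x0 e <= meets x0 e.
Proof.
  apply indic_le. intros (lam & H1 & H2 & _).
  destruct (Rle_or_lt (fst (fst e)) (fst (snd e))); [left|right]; nra.
Qed.

Lemma esum_window_meets_zero (a x0 : R) (E : list edge) :
  (forall p, vertex p E -> a + 1 < snd p) \/ (forall p, vertex p E -> snd p < a) ->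
  esum (window_meets a x0) E = 0.
Proof.
  intros H. apply esum_zero. intros e He. apply indic_false. intros (lam & H1 & _ & H3).
  assert (V1 : vertex (fst e) E) by (exists e; auto).
  assert (V2 : vertex (snd e) E) by (exists e; auto).
  destruct (Rle_or_lt (snd (fst e)) (snd (snd e)));
    destruct H as [H|H]; pose proof (H _ V1); pose proof (H _ V2); nra.
Qed.

(* A closed window of height 1 meets at most three of the closed strips of height 1; the last
   two bounds are what the induction from bottom to top needs. *)
Lemma stack_surgery (K : R) (m : nat) (h : R) (E F : list edge) :
  0 < K -> closed (E ++ F) ->
  (forall p, vertex p E -> h <= snd p <= h + INR m) ->
  (forall p, vertex p F -> snd p <= h) ->
  exists E', closed (E' ++ F) /\ (forall p, vertex p E' -> h <= snd p) /\
    esum ecost E' <= (1 + 5 / K) * esum ecost E /\ covers E E' /\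
    (forall a x0, esum (window_meets a x0) E' <= 3 * (4 * K + 28) /\
      (a < h + 1 -> esum (window_meets a x0) E' <= 2 * (4 * K + 28)) /\
      (a < h -> esum (window_meets a x0) E' <= 4 * K + 28)).
Proof.
  intros HK. revert h E F. induction m as [|m IH]; intros h E F Hc HE HF.
  (* With [m = 0] all of [E] lies on the line at height [h], and a single strip suffices. *)
  - destruct (whole_strip_surgery h K E F) as (E' & H1 & H2 & H3 & H4 & H5); auto.
    { intros p Hp. apply HE in Hp. simpl in Hp. lra. }
    { intros p Hp. apply HF in Hp. lra. }
    exists E'. repeat split; auto; try (intros p Hp; apply H2 in Hp; lra).
    all: intros; assert (esum (window_meets a x0) E' <= esum (meets x0) E')
      by (apply esum_le; intros; apply window_meets_le); specialize (H5 x0); lra.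
  - set (EL := flat_map (cut_low snd (h + 1)) E). set (EH := flat_map (cut_high snd (h + 1)) E).
    pose proof (cut_closed snd (h + 1) affine_snd E F Hc) as Hcut. fold EL EH in Hcut.
    pose proof (cut_cost snd (h + 1) affine_snd E) as Hcost. fold EL EH in Hcost.
    assert (Hbox : forall p, vertex p EL \/ vertex p EH -> h <= snd p <= h + INR (S m)).
    { apply (cut_convex snd (h + 1) affine_snd (fun p => h <= snd p <= h + INR (S m))); auto.
      intros u v lam Hlam Hu Hv. simpl (snd (lerp _ _ _)). nra. }
    rewrite S_INR in Hbox.
    assert (HEL : forall p, vertex p EL -> snd p <= h + 1)
      by (intros; now apply (cut_low_vertex snd (h + 1) affine_snd E)).
    assert (HEH : forall p, vertex p EH -> h + 1 <= snd p)
      by (intros; now apply (cut_high_vertex snd (h + 1) affine_snd E)).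
    destruct (whole_strip_surgery h K EL (EH ++ F)) as (EL' & A1 & A2 & A3 & A4 & A5); auto.
    { intros p Hp. split; [apply Hbox|]; auto. }
    { intros p Hp. apply vertex_app in Hp. destruct Hp as [Hp|Hp].
      - apply HEH in Hp. lra. - apply HF in Hp. lra. }
    destruct (IH (h + 1) EH (EL' ++ F)) as (EH' & B1 & B2 & B3 & B4 & B5).
    { eapply closed_perm; [|exact A1]. perm. }
    { intros p Hp. split; auto. pose proof (Hbox p (or_intror Hp)). lra. }
    { intros p Hp. apply vertex_app in Hp. destruct Hp as [Hp|Hp].
      - apply A2 in Hp. lra. - apply HF in Hp. lra. }
    exists (EL' ++ EH'). split; [|split; [|split; [|split]]].
    + eapply closed_perm; [|exact B1]. perm.
    + intros p Hp. apply vertex_app in Hp. destruct Hp as [Hp|Hp].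
      * apply A2 in Hp. lra.
      * apply B2 in Hp. lra.
    + rewrite esum_app, <- Hcost. lra.
    + now apply covers_cut with snd (h + 1); [apply affine_snd| |].
    + intros a x0. rewrite esum_app. destruct (B5 a x0) as (B6 & B7 & B8).
      assert (HA : esum (window_meets a x0) EL' <= 4 * K + 28).
      { apply Rle_trans with (esum (meets x0) EL'); auto.
        apply esum_le; intros; apply window_meets_le. }
      split; [|split].
      (* For [a = h + 1] the window touches this strip and the next two, which is the extreme
         case. *)
      * destruct (Rle_or_lt a (h + 1)) as [Ha|Ha].
        -- assert (Ha' : a < h + 1 + 1) by lra. specialize (B7 Ha'). lra.
        -- rewrite (esum_window_meets_zero a x0 EL'); [lra|]. right. intros p Hp.
           apply A2 in Hp. lra.
      * intros Ha. specialize (B8 Ha). lra.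
      * intros Ha. rewrite (esum_window_meets_zero a x0 EH'); [lra|]. left. intros p Hp.
        apply B2 in Hp. lra.
Qed.

(** * Tours *)

Fixpoint path_edges (p : point) (l : list point) : list edge :=
  match l with
  | [] => []
  | q :: l' => (p, q) :: path_edges q l'
  end.

(** Repeating the first point at the end turns the cyclic sequence into a path, on which induction
    is possible. *)
Lemma legs_path_edges (p : point) (l : list point) : legs (p :: l) = path_edges p (l ++ [p]).
Proof.
  assert (H : forall x q, combine (q :: l) (l ++ [x]) = path_edges q (l ++ [x])).
  { intros x. induction l as [|a l IH]; intros q; simpl; auto. f_equal. apply IH. }
  apply H.
Qed.

Lemma walk_path_edges (p q : point) (l : list point) : walk p q (path_edges p (l ++ [q])).
Proof.
  revert p. induction l as [|a l IH]; intros p; simpl.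
  - apply walk_edge. now left.
  - econstructor; [now left|apply IH].
Qed.

Lemma vertex_path_edges (p q : point) (l : list point) :
  (vertex q (path_edges p l) -> q = p \/ In q l) /\ (In q l -> vertex q (path_edges p l)).
Proof.
  revert p. induction l as [|a l IH]; intros p; simpl; split; intros H.
  - now apply vertex_nil in H.
  - destruct H.
  - apply vertex_cons in H. simpl in H. destruct H as [H|[H|H]]; auto.
    apply IH in H. destruct H; auto.
  - apply vertex_cons. simpl. destruct H as [H|H]; auto. right; right. now apply IH.
Qed.

Lemma legs_closed (t : tour) : t <> [] -> closed (legs t).
Proof.
  destruct t as [|p l]; [tauto|]. intros _. rewrite legs_path_edges.
  exists p. apply walk_path_edges.
Qed.

Lemma legs_vertex (t : tour) (p : point) : vertex p (legs t) <-> In p t.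
Proof.
  destruct t as [|q l]; [split; [apply vertex_nil|intros []]|].
  rewrite legs_path_edges. destruct (vertex_path_edges q p (l ++ [q])) as [H1 H2].
  rewrite in_app_iff in *. simpl in *. intuition.
Qed.

Definition flip_invariant (f : edge -> R) : Prop := forall u v, f (u, v) = f (v, u).

(** An edge may be traversed against its stored direction, so only sums of flip-invariant weights
    are preserved. *)
Lemma walk_to_path (u v : point) (E : list edge) :
  walk u v E ->
  exists l, length l = length E /\ last l u = v /\
    (forall f, flip_invariant f -> esum f (path_edges u l) = esum f E) /\
    (forall p, vertex p E -> vertex p (path_edges u l)).
Proof.
  induction 1 as [u|u v w e E Hj Hw (l & H1 & H2 & H3 & H4)
                 |u v E F HP Hw (l & H1 & H2 & H3 & H4)].
  - exists []. auto.
  - exists (v :: l). split; [simpl; auto|]. split; [|split].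
    + destruct l as [|a l]; auto. rewrite <- H2. clear.
      revert a. induction l as [|b l IH]; intros a; auto. apply IH.
    + intros f Hf. simpl path_edges. rewrite !esum_cons, (H3 f Hf).
      destruct Hj as [->| ->]; auto. now rewrite Hf.
    + intros p Hp. simpl. rewrite vertex_cons. simpl.
      apply (vertex_joins_cons _ _ _ _ _ Hj) in Hp. destruct Hp as [?|[?|?]]; auto.
  - exists l. repeat split; auto.
    + rewrite H1. now apply Permutation_length.
    + intros f Hf. rewrite (H3 f Hf). now apply esum_perm.
    + intros p Hp. apply H4. eapply vertex_perm; [apply Permutation_sym|]; eauto.
Qed.

Lemma closed_to_tour (E : list edge) :
  closed E -> E <> [] ->
  exists t, t <> [] /\ (forall f, flip_invariant f -> esum f (legs t) = esum f E) /\
    (forall p, vertex p E -> In p t).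
Proof.
  intros [u Hu] HE. destruct (walk_to_path _ _ _ Hu) as (l & H1 & H2 & H3 & H4).
  (* The path returns to [u]; its last point is removed because [legs] closes the tour by itself. *)
  destruct l as [|a l] using rev_ind; [destruct E; simpl in *; [tauto|lia]|].
  rewrite last_last in H2. subst a. exists (u :: l).
  split; [discriminate|]. split.
  - intros f Hf. rewrite legs_path_edges. auto.
  - intros p Hp. apply legs_vertex. rewrite legs_path_edges. auto.
Qed.

Lemma ecost_flip : flip_invariant ecost.
Proof. intros u v. apply dist2_sym. Qed.

Lemma window_meets_flip (a x0 : R) : flip_invariant (window_meets a x0).
Proof.
  assert (H : forall u v, piece_meets a x0 (u, v) -> piece_meets a x0 (v, u)).
  { intros u v (lam & H1 & H2 & H3). exists (1 - lam). cbn [fst snd] in *.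
    split; [lra|]. split; nra. }
  intros u v. apply Rle_antisym; apply indic_le; apply H.
Qed.

Lemma shadow_esum (t : tour) (a x0 : R) :
  INR (shadow_at t a x0) = esum (window_meets a x0) (legs t).
Proof.
  unfold shadow_at. induction (legs t) as [|e E IH]; auto.
  rewrite esum_cons. cbn [filter]. unfold window_meets at 1, indic. unfold decide at 1.
  destruct (excluded_middle_informative (piece_meets a x0 e)).
  - cbn [length]. rewrite S_INR, IH. lra.
  - rewrite IH. lra.
Qed.

Lemma cost_esum (t : tour) : cost t = esum ecost (legs t).
Proof. reflexivity. Qed.

Lemma low_shadow_tour (inst : list vseg) (t : tour) (eps : R) :
  0 < eps -> feasible inst t ->
  exists t', feasible inst t' /\ cost t' <= (1 + eps) * cost t /\
    (forall a x0, INR (shadow_at t' a x0) <= 60 / eps + 84).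
Proof.
  intros He [Ht Hf].
  assert (Hn : exists p, In p t) by (destruct t as [|p t]; [tauto|exists p; simpl; auto]).
  destruct Hn as (p0 & Hp0).
  assert (Hex : exists p, vertex p (legs t) /\ True) by (exists p0; now rewrite legs_vertex).
  destruct (exists_vertex_max snd (fun _ => True) (legs t) Hex) as (v & _ & _ & Hv).
  destruct (exists_vertex_max (fun p => - snd p) (fun _ => True) (legs t) Hex)
    as (w & _ & _ & Hw).
  destruct (INR_unbounded (snd v - snd w)) as (m & Hm).
  (* With [K = 5 / eps] the cost factor [1 + 5 / K] is [1 + eps], and [3 * (4 * K + 28)] is
     [60 / eps + 84]. *)
  assert (HK : 0 < 5 / eps) by (apply Rdiv_lt_0_compat; lra).
  destruct (stack_surgery (5 / eps) m (snd w) (legs t) []) as (E & H1 & H2 & H3 & H4 & H5); auto.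
  { rewrite app_nil_r. now apply legs_closed. }
  { intros p Hp. specialize (Hv p Hp I). specialize (Hw p Hp I). simpl in Hw. lra. }
  { intros p Hp. now apply vertex_nil in Hp. }
  rewrite app_nil_r in H1.
  (* The unit segment with lower end [p0] has to stay visited, so some vertex remains. *)
  assert (HE : E <> []).
  { intros ->. apply legs_vertex in Hp0. destruct (H4 p0 p0 Hp0) as (q & Hq & _).
    - unfold on_vseg. lra.
    - now apply vertex_nil in Hq. }
  destruct (closed_to_tour E H1 HE) as (t' & G1 & G2 & G3).
  exists t'. split; [|split].
  - split; auto. intros s Hs. destruct (Hf s Hs) as (p & Hp & Hps).
    apply legs_vertex in Hp. destruct (H4 s p Hp Hps) as (q & Hq & Hqs). eauto.
  - rewrite !cost_esum, (G2 _ ecost_flip).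
    replace (5 / (5 / eps)) with eps in H3 by (field; lra). auto.
  - intros a x0. rewrite shadow_esum, (G2 _ (window_meets_flip a x0)).
    destruct (H5 a x0) as [H6 _]. unfold Rdiv in *. lra.
Qed.

(** * Near-optimal tours *)

Lemma walk_dist2_le (u v : point) (E : list edge) : walk u v E -> dist2 u v <= esum ecost E.
Proof.
  induction 1 as [u|u v w e E Hj Hw IH|u v E F HP Hw IH].
  - rewrite dist2_refl. simpl. lra.
  - rewrite esum_cons, (ecost_joins _ _ _ Hj). pose proof (dist2_triangle u w v). lra.
  - now rewrite <- (esum_perm _ _ _ HP).
Qed.

Lemma dist2_le_cost (t : tour) (p q : point) : In p t -> In q t -> dist2 p q <= cost t.
Proof.
  intros Hp Hq.
  assert (Hc : closed (legs t)) by (apply legs_closed; intros ->; destruct Hp).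
  apply legs_vertex in Hp, Hq.
  destruct (walk_split_vertex _ _ q _ (closed_at _ _ Hc Hp) (or_intror Hq))
    as (E1 & E2 & H1 & _ & H3).
  rewrite cost_esum, (esum_perm _ _ _ H3), esum_app.
  pose proof (walk_dist2_le _ _ _ H1). pose proof (esum_nonneg ecost E2 ecost_nonneg). lra.
Qed.

Lemma cost_nonneg (t : tour) : 0 <= cost t.
Proof. apply (esum_nonneg ecost), ecost_nonneg. Qed.

(** The encoding [(x, b)] of a segment is also its lower end point, so the instance itself serves as
    a list of visits; one more point makes the list nonempty. *)
Lemma exists_feasible (inst : list vseg) : exists t, feasible inst t.
Proof.
  exists ((0, 0) :: inst). split; [discriminate|]. intros s Hs. exists s. split; [now right|].
  unfold on_vseg. lra.
Qed.

(** Arbitrarily cheap tours force any two segments to have equal abscissas and to intersect. As with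
    intervals on a line, the highest lower end point then belongs to all of them. *)
Lemma common_point (inst : list vseg) :
  (forall eta, 0 < eta -> exists t, feasible inst t /\ cost t < eta) ->
  exists p, forall s, In s inst -> on_vseg s p.
Proof.
  intros H.
  assert (Hpair : forall s s' eta, In s inst -> In s' inst -> 0 < eta -> exists p q,
    on_vseg s p /\ on_vseg s' q /\ Rabs (fst p - fst q) < eta /\ Rabs (snd p - snd q) < eta).
  { intros s s' eta Hs Hs' Heta. destruct (H eta Heta) as (t & [_ Hf] & Hc).
    destruct (Hf s Hs) as (p & Hp & Hps). destruct (Hf s' Hs') as (q & Hq & Hqs).
    exists p, q. pose proof (dist2_le_cost t p q Hp Hq).
    pose proof (dist2_ge_fst p q). pose proof (dist2_ge_snd p q).
    repeat split; try apply Hps; try apply Hqs; lra. }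
  destruct (excluded_middle_informative (inst = [])) as [->|Hn]; [exists (0, 0); intros s []|].
  destruct (exists_max snd inst Hn) as (s' & Hs' & Hmax).
  exists s'. intros s Hs. unfold on_vseg. split; [|split; [now apply Hmax|]].
  - destruct (Req_dec (fst s') (fst s)) as [|Hne]; auto. exfalso.
    destruct (Hpair s s' (Rabs (fst s - fst s')) Hs Hs') as (p & q & H1 & H2 & H3 & _).
    { apply Rabs_pos_lt. lra. }
    destruct H1 as [H1 _], H2 as [H2 _]. rewrite H1, H2 in H3. lra.
  - destruct (Rle_or_lt (snd s') (snd s + 1)) as [|Hlt]; auto. exfalso.
    destruct (Hpair s s' (snd s' - (snd s + 1)) Hs Hs') as (p & q & H1 & H2 & _ & H3); [lra|].
    destruct H1 as [_ H1], H2 as [_ H2]. apply Rabs_def2 in H3. lra.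
Qed.

(** The infimum of the costs takes the place of an optimum tour. If it is positive, some tour lies
    within the factor [1 + eps] of it; if it is zero, the segments have a common point. Completeness
    is applied to the negated costs, so the infimum is [- m]. *)
Lemma near_optimal_tour (inst : list vseg) (eps : R) :
  0 < eps ->
  (exists p, forall s, In s inst -> on_vseg s p) \/
  exists t, feasible inst t /\ forall t', feasible inst t' -> cost t <= (1 + eps) * cost t'.
Proof.
  intros He.
  destruct (completeness (fun c => exists t, feasible inst t /\ c = - cost t))
    as (m & Hub & Hlub).
  { exists 0. intros c (t & _ & ->). pose proof (cost_nonneg t). lra. }
  { destruct (exists_feasible inst) as (t & Ht). eauto. }
  assert (Hm : forall t, feasible inst t -> - m <= cost t).
  { intros t Ht. assert (- cost t <= m) by (apply Hub; eauto). lra. }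
  assert (Happ : forall d, 0 < d -> exists t, feasible inst t /\ cost t < - m + d).
  { intros d Hd.
    destruct (excluded_middle_informative (exists t, feasible inst t /\ cost t < - m + d))
      as [|Hno]; auto.
    exfalso. assert (m <= m - d); [|lra]. apply Hlub. intros c (t & Ht & ->).
    destruct (Rle_or_lt (- m + d) (cost t)); [lra|]. exfalso; eauto. }
  destruct (Rle_or_lt 0 m) as [Hm0|Hm0].
  - left. apply common_point. intros eta Heta. destruct (Happ eta Heta) as (t & Ht & Hc).
    exists t. split; auto. lra.
  - right. destruct (Happ (eps * - m)) as (t & Ht & Hc); [apply Rmult_lt_0_compat; lra|].
    exists t. split; auto. intros t' Ht'. specialize (Hm t' Ht'). nra.
Qed.

(** Comparison with every feasible tour stands for comparison with [opt]. The term [1 + / eps] takes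
    care of large [eps], since every tour has a leg and hence a shadow of at least 1 in some
    window. *)
Theorem theorem2 :
  exists C : R,
    forall (inst : list vseg) (eps : R), 0 < eps ->
      exists t' : tour,
        feasible inst t' /\
        (forall t : tour, feasible inst t -> cost t' <= (1 + eps) * cost t) /\
        (forall a x0 : R, INR (shadow_at t' a x0) <= C * (1 + / eps)).
Proof.
  (* Near-optimality and surgery each cost a factor [1 + d] with [d] a third of the minimum of [eps]
     and 1; then [(1 + d) * (1 + d) <= 1 + 3 * d <= 1 + eps]. The constant is [180 + 84], from
     [60 / d + 84]. *)
  exists 264. intros inst eps Heps.
  assert (Hinv : 0 < / eps) by now apply Rinv_0_lt_compat.
  assert (Hd : exists d, 0 < d <= 1 / 3 /\ 3 * d <= eps /\ 60 / d <= 180 * (1 + / eps)).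
  { destruct (Rle_or_lt eps 1) as [H|H].
    - exists (eps / 3). repeat split; try lra.
      replace (60 / (eps / 3)) with (180 * / eps) by (field; lra). lra.
    - exists (1 / 3). repeat split; lra. }
  destruct Hd as (d & Hd1 & Hd2 & Hd3).
  destruct (near_optimal_tour inst d) as [(p & Hp)|(t & Ht & Hopt)]; [lra| |].
  (* The tour with the single point [p] has cost 0 and one degenerate leg. *)
  - exists [p]. split; [|split].
    + split; [discriminate|]. intros s Hs. exists p. simpl; auto.
    + intros t _. unfold cost at 1. simpl. rewrite dist2_refl. pose proof (cost_nonneg t). nra.
    + intros a x0. rewrite shadow_esum. cbn [legs combine app]. rewrite esum_cons.
      pose proof (window_meets_le a x0 (p, p)). pose proof (meets_bounds x0 (p, p)). simpl. lra.
  - destruct (low_shadow_tour inst t d) as (t' & H1 & H2 & H3); [lra|auto|].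
    exists t'. split; auto. split.
    + intros s Hs. specialize (Hopt s Hs). pose proof (cost_nonneg s).
      apply Rle_trans with (((1 + d) * (1 + d)) * cost s).
      * rewrite Rmult_assoc. apply Rle_trans with (1 := H2), Rmult_le_compat_l; lra.
      * apply Rmult_le_compat_r; auto. nra.
    + intros a x0. specialize (H3 a x0). lra.
Qed.
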